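(* Let $\mu$ be a spin system on $\mathcal Y=\mathcal X^{\mathcal I}$ for finite sets $\mathcal X$ and $\mathcal I$. Assume that for some constants $\alpha_1,\alpha_2>0$ we have the lower bound on the conditional probabilities $$\tilde\beta(\mu)\ge\alpha_1$$ and an upper bound on some interdependence matrix $J$ $$\|J\|_{2\to2}\le1-\alpha_2 .$$ The Glauber dynamics associated to $\mu$ satisfies an $\mathrm{mLSI}(2|\mathcal I|\alpha_1^{-1}\alpha_2^{-2})$. As a consequence, given any $\mu$-density $f$, the density $P_tf$ (where $(P_t)_{t\ge0}$ is the Glauber semigroup) satisfies $$\mathrm{Ent}_\mu(P_tf)\le\mathrm{Ent}_\mu(f)\exp\left(-\frac{\alpha_1\alpha_2^2}{2|\mathcal I|}t\right).$$ Furthermore, if $(\mu_n)_n$ is a sequence of spin systems on $\mathcal Y_n=\mathcal X^{\mathcal I_n}$ (with $|\mathcal I_n|\to\infty$) such that $\tilde\beta(\mu_n)\ge\alpha_1$ and $\|J_n\|_{2\to2}\le1-\alpha_2$ for some interdependence matrix $J_n$ of $\mu_n$, with $n$-independent constants $\alpha_1,\alpha_2>0$, then the sequence of Glauber dynamics is rapidly mixing, i.e. $t_{\mathrm{mix}}=O(|\mathcal I_n|\log|\mathcal I_n|)$.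
   Context: A (finite) spin system is a probability measure $\mu$ on $\mathcal Y=\mathcal X^{\mathcal I}$ with $\mathcal X,\mathcal I$ finite. For $x\in\mathcal Y$, $\overline{x}_i=(x_j)_{j\ne i}$, and $\mu(\cdot\mid\overline x_i)$ denotes the conditional probability of the $i$-th coordinate given the others, interpreted as a measure on $\mathcal X$. Interdependence matrix: any matrix $J=(J_{ij})_{i,j\in\mathcal I}$ with $J_{ii}=0$ and such that for any $x,y\in\mathcal Y$ with $\overline x_j=\overline y_j$ we have $d_{\mathrm{TV}}(\mu(\cdot\mid\overline x_i),\mu(\cdot\mid\overline y_i))\le J_{ij}$. Here $d_{\mathrm{TV}}(\mu_1,\mu_2)=\frac12\sum_x|\mu_1(x)-\mu_2(x)|$. $\|J\|_{2\to2}$ is the operator norm with respect to the Euclidean norm. For $S\subsetneq\mathcal I$ and $i\notin S$ let $$\tilde\beta_{i,S}(\mu)=\inf_{x_S\in\mathcal X^S:\ \mu_S(x_S)>0}\ \inf_{y_{S^c}\in\mathcal X^{S^c}:\ \mu(y_{S^c},x_S)>0}\mu((y_{S^c})_i\mid x_S),$$ where $\mu_S$ is the marginal of $\mu$ on $\mathcal X^S$ and $\mu((y_{S^c})_i\mid x_S)$ is the conditional probability that the $i$-th coordinate equals $(y_{S^c})_i$ given that the coordinates in $S$ equal $x_S$ (for $S=\emptyset$: the marginal probability). Set $\tilde\beta(\mu)=\inf_{S\subsetneq\mathcal I}\inf_{i\notin S}\tilde\beta_{i,S}(\mu)$. Glauber dynamics: the Markov chain on $\operatorname{supp}\mu$ with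 transition matrix $P(x,y)=|\mathcal I|^{-1}\sum_{i\in\mathcal I}\mu(y_i\mid\overline x_i)\prod_{j\ne i}\mathbf 1_{x_j=y_j}$; it is reversible with respect to $\mu$. With $L=P-I$, the Glauber semigroup is $P_t=e^{tL}$ (continuous time), and $P^t(y,\cdot)$ is the law at time $t$ of the continuous-time chain started at $y$. $\mathrm{Ent}_\mu(f)=\mathbb E_\mu f\log f-\mathbb E_\mu f\log\mathbb E_\mu f$ for $f\ge0$, $\mathcal E(f,g)=\mathbb E_\mu f(-Lg)$. $\mathrm{mLSI}(\rho_0)$ means: $\mathrm{Ent}_\mu(f)\le\frac{\rho_0}2\mathcal E(f,\log f)$ for all $f:\operatorname{supp}\mu\to(0,\infty)$. A $\mu$-density is a function $f\ge0$ with $\mathbb E_\mu f=1$. $t_{\mathrm{mix}}=\inf\{t\ge0:\max_{y\in\operatorname{supp}\mu}d_{\mathrm{TV}}(P^t(y,\cdot),\mu)\le e^{-1}\}$. *)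

(* Defs.v *)
From HB Require Import structures.
From mathcomp Require Import all_boot all_order all_algebra.
From mathcomp Require Import all_classical all_reals all_analysis.

Set Implicit Arguments.
Unset Strict Implicit.
Unset Printing Implicit Defensive.

Import Order.TTheory GRing.Theory Num.Theory.
Import numFieldNormedType.Exports.

Local Open Scope classical_set_scope.
Local Open Scope ring_scope.

Record spin_system (R : realType) (X I : finType) := SpinSystem {
  mass :> {ffun I -> X} -> R;
  mass_ge0 : forall x, 0 <= mass x;
  mass_sum1 : \sum_x mass x = 1 }.

Definition dTV (R : realType) (T : finType) (p q : T -> R) : R :=
  2^-1 * \sum_x `|p x - q x|.

(* A partial configuration x_S in X^S is represented by any full configuration
   x extending it; everything below depends on x only through [agree S]. *)
Definition agree (X I : finType) (S : {set I}) (x y : {ffun I -> X}) : bool :=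
  [forall j in S, x j == y j].

Definition marginal (R : realType) (X I : finType) (mu : spin_system R X I)
    (S : {set I}) (x : {ffun I -> X}) : R :=
  \sum_(z | agree S z x) mu z.

(* mu(z_i = a | z_S = x_S); its value is 0 when mu_S(x_S) = 0. *)
Definition cond_prob (R : realType) (X I : finType) (mu : spin_system R X I)
    (S : {set I}) (x : {ffun I -> X}) (i : I) (a : X) : R :=
  (\sum_(z | agree S z x && (z i == a)) mu z) / marginal mu S x.

(* The conditioning configuration is x off the site i. *)
Definition site_cond (R : realType) (X I : finType) (mu : spin_system R X I)
    (i : I) (x : {ffun I -> X}) (a : X) : R :=
  cond_prob mu [set~ i]%SET x i a.

(* A version of the single-site conditional probabilities: q i x is a
   probability measure on X, it depends on x only off i, and it is the elementary
   conditional probability whenever x off i has positive mass (it is not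
   determined by mu otherwise). *)
Definition is_cond_version (R : realType) (X I : finType)
    (mu : spin_system R X I) (q : I -> {ffun I -> X} -> X -> R) : Prop :=
  [/\ forall i x a, 0 <= q i x a,
      forall i x, \sum_a q i x a = 1,
      forall i x y, agree [set~ i]%SET x y -> q i x = q i y
    & forall i x, 0 < marginal mu [set~ i]%SET x -> q i x = site_cond mu i x].

(* Configurations x, y differing at j only are compared even if mu gives no mass
   to x or y off i. Restricting to conditionings of positive mass would make the
   notion too weak: J = 0 would be allowed for the uniform measure on the two
   constant configurations of {0,1}^3, for which the Glauber dynamics is frozen. *)
Definition interdependence (R : realType) (X I : finType)
    (mu : spin_system R X I) (J : I -> I -> R) : Prop :=
  (forall i, J i i = 0) /\
  exists2 q, is_cond_version mu q &
    forall i j x y, agree [set~ j]%SET x y -> dTV (q i x) (q i y) <= J i j.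

Definition norm2 (R : realType) (I : finType) (v : I -> R) : R :=
  Num.sqrt (\sum_i v i ^+ 2).

Definition opnorm2 (R : realType) (I : finType) (J : I -> I -> R) : R :=
  sup [set norm2 (fun i => \sum_j J i j * v j) | v in [set v | norm2 v <= 1]].

(* Infima are taken in \bar R, so that the infimum of an empty family is +oo. *)
Definition beta_site (R : realType) (X I : finType) (mu : spin_system R X I)
    (i : I) (S : {set I}) : \bar R :=
  ereal_inf [set
    ereal_inf [set (cond_prob mu S x i (y i))%:E
      | y in [set y : {ffun I -> X} | agree S y x /\ 0 < mu y]]
    | x in [set x | 0 < marginal mu S x]].

Definition beta (R : realType) (X I : finType) (mu : spin_system R X I)
    : \bar R :=
  ereal_inf [set
    ereal_inf [set beta_site mu i S | i in [set i : I | i \notin S]]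
    | S in [set S : {set I} | S \proper [set: I]%SET]].

Definition supp (R : realType) (X I : finType) (mu : spin_system R X I)
  : finType := {x : {ffun I -> X} | 0 < mu x}.

Definition expect (R : realType) (X I : finType) (mu : spin_system R X I)
    (f : supp mu -> R) : R :=
  \sum_x mu (val x) * f x.

(* ln 0 = 0, hence 0 * ln 0 = 0. *)
Definition entropy (R : realType) (X I : finType) (mu : spin_system R X I)
    (f : supp mu -> R) : R :=
  expect (fun x => f x * ln (f x)) - expect f * ln (expect f).

Definition glauber (R : realType) (X I : finType) (mu : spin_system R X I)
    (x y : supp mu) : R :=
  #|I|%:R^-1 * \sum_i site_cond mu i (val x) (val y i) *
    \prod_(j | j != i) (val x j == val y j)%:R.

Definition generator (R : realType) (X I : finType) (mu : spin_system R X I)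
    (f : supp mu -> R) : supp mu -> R :=
  fun x => \sum_y glauber x y * f y - f x.

(* exp(tL) f, with exp_coeff t k = t ^+ k / k`!%:R. *)
Definition semigroup (R : realType) (X I : finType) (mu : spin_system R X I)
    (t : R) (f : supp mu -> R) : supp mu -> R :=
  fun x => limn (series (fun k => exp_coeff t k * iter k (@generator R X I mu) f x)).

Definition glauber_law (R : realType) (X I : finType) (mu : spin_system R X I)
    (t : R) (y x : supp mu) : R :=
  semigroup t (fun z => (z == x)%:R) y.

Definition dirichlet (R : realType) (X I : finType) (mu : spin_system R X I)
    (f g : supp mu -> R) : R :=
  expect (fun x => f x * - generator g x).

Definition mLSI (R : realType) (X I : finType) (mu : spin_system R X I)
    (rho : R) : Prop :=
  forall f : supp mu -> R, (forall x, 0 < f x) ->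
    entropy f <= rho / 2 * dirichlet f (fun x => ln (f x)).

Definition is_density (R : realType) (X I : finType) (mu : spin_system R X I)
    (f : supp mu -> R) : Prop :=
  (forall x, 0 <= f x) /\ expect f = 1.

(* Equal to +oo for a chain that never mixes. *)
Definition tmix (R : realType) (X I : finType) (mu : spin_system R X I)
    : \bar R :=
  ereal_inf [set t%:E | t in [set t : R | 0 <= t /\
    \big[Num.max/0]_(y : supp mu)
      dTV (glauber_law t y) (fun x => mu (val x)) <= expR (-1)]].

(* Main.v *)
(* Tensorize the entropy by the chain rule, averaged over which coordinate is
   revealed next.  After conditioning on the coordinates in S, revealing one more
   coordinate i costs the relative entropy of the law of x_i under f mu with
   respect to mu; it is at most chi-square, hence by the lower bound a1 at most
   (2 / a1) times the squared total variation distance of the two laws.  These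
   distances are controlled by Dobrushin's comparison method: the smallest
   vector a with |f mu (g) - mu (g)| <= sum_j a_j osc_j (g) for all g satisfies
   a <= eps + J a, where eps_i is the total variation distance between the two
   single-site conditional laws at i averaged over f mu, so
   a2 |a| <= |eps| in Euclidean norm.  A Pinsker-type inequality bounds eps_i ^ 2
   by the i-th term of the Dirichlet form.  Summing over i, the same bound holds
   for every S, and induction on the complement of S yields the mLSI.  Entropy
   decay follows by differentiating along the semigroup, and rapid mixing by
   starting from a point mass, whose entropy is at most |I| ln (1 / a1). *)

Require Import Defs.
From HB Require Import structures.
From mathcomp Require Import all_boot all_order all_algebra.
From mathcomp Require Import all_classical all_reals all_analysis.
From mathcomp Require Import ring lra.

Set Implicit Arguments.
Unset Strict Implicit.
Unset Printing Implicit Defensive.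

Import Order.TTheory GRing.Theory Num.Theory.
Import numFieldNormedType.Exports.

Local Open Scope classical_set_scope.
Local Open Scope ring_scope.

(** * Cauchy-Schwarz, Euclidean norms and oscillation bounds for finite sums *)

Section FiniteSums.
Context {R : realType}.

(** Lagrange's identity: the gap between the two sides is half the sum of the squared minors
    [u i * v j - u j * v i]. *)
Lemma cauchy_schwarz_sum (T : finType) (u v : T -> R) :
  (\sum_i u i * v i) ^+ 2 <= (\sum_i u i ^+ 2) * (\sum_i v i ^+ 2).
Proof.
have : 0 <= \sum_i \sum_j (u i * v j - u j * v i) ^+ 2.
  by apply: sumr_ge0 => i _; apply: sumr_ge0 => j _; exact: sqr_ge0.
have -> : \sum_i \sum_j (u i * v j - u j * v i) ^+ 2 =
  2 * ((\sum_i u i ^+ 2) * (\sum_i v i ^+ 2) - (\sum_i u i * v i) ^+ 2).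
  transitivity (\sum_i \sum_j (u i ^+ 2 * v j ^+ 2 + v i ^+ 2 * u j ^+ 2
     - 2 * ((u i * v i) * (u j * v j)))).
    by apply: eq_bigr => i _; apply: eq_bigr => j _; ring.
  under eq_bigr => i _ do rewrite sumrB big_split /= -!mulr_sumr.
  rewrite sumrB big_split /= -!mulr_suml -mulr_sumr -mulr_suml expr2.
  ring.
by rewrite pmulr_rge0 // subr_ge0.
Qed.

Lemma norm2_ge0 (T : finType) (v : T -> R) : 0 <= norm2 v.
Proof. exact: sqrtr_ge0. Qed.

Lemma sqr_norm2 (T : finType) (v : T -> R) : norm2 v ^+ 2 = \sum_i v i ^+ 2.
Proof. by rewrite sqr_sqrtr // sumr_ge0 // => i _; exact: sqr_ge0. Qed.

Lemma sum_mul_le_norm2 (T : finType) (u v : T -> R) :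
  \sum_i u i * v i <= norm2 u * norm2 v.
Proof.
apply: le_trans (ler_norm _) _.
rewrite -[leRHS]ger0_norm ?mulr_ge0 ?norm2_ge0 // -ler_sqr ?nnegrE //.
by rewrite !real_normK ?num_real // exprMn !sqr_norm2 cauchy_schwarz_sum.
Qed.

Lemma le_norm2 (T : finType) (u v : T -> R) :
  (forall i, 0 <= u i <= v i) -> norm2 u <= norm2 v.
Proof.
move=> uv; rewrite ler_wsqrtr //; apply: ler_sum => i _.
have /andP[u0 uv0] := uv i.
by rewrite lerXn2r ?nnegrE // (le_trans u0).
Qed.

Lemma norm2D (T : finType) (u v : T -> R) :
  norm2 (fun i => u i + v i) <= norm2 u + norm2 v.
Proof.
rewrite -ler_sqr ?nnegrE ?addr_ge0 ?norm2_ge0 //.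
rewrite sqrrD !sqr_norm2.
have -> : \sum_i (u i + v i) ^+ 2 =
  \sum_i u i ^+ 2 + 2 * (\sum_i u i * v i) + \sum_i v i ^+ 2.
  rewrite mulr_sumr -!big_split /=; apply: eq_bigr => i _; ring.
rewrite lerD2r lerD2l -[leRHS]mulr_natl ler_pM2l //.
exact: sum_mul_le_norm2.
Qed.

Lemma norm2Z (T : finType) (c : R) (v : T -> R) : 0 <= c ->
  norm2 (fun i => c * v i) = c * norm2 v.
Proof.
move=> c0; rewrite /norm2.
under eq_bigr do rewrite exprMn.
by rewrite -mulr_sumr sqrtrM ?sqr_ge0 // sqrtr_sqr ger0_norm.
Qed.

Lemma norm2_eq0 (T : finType) (v : T -> R) : norm2 v = 0 -> forall i, v i = 0.
Proof.
move=> v0 i.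
have : \sum_i v i ^+ 2 = 0 by rewrite -sqr_norm2 v0 expr0n.
move/eqP; rewrite psumr_eq0 => [/allP /(_ i)|j _]; last exact: sqr_ge0.
by rewrite mem_index_enum => /(_ isT); rewrite sqrf_eq0 => /eqP.
Qed.

Lemma norm2_mulmx_le (T : finType) (J : T -> T -> R) (v : T -> R) :
  norm2 (fun i => \sum_j J i j * v j) <= opnorm2 J * norm2 v.
Proof.
have norm2_0 (w : T -> R) : (forall i, w i = 0) -> norm2 w = 0.
  by move=> w0; rewrite /norm2 big1 ?sqrtr0 // => i _; rewrite w0 expr0n.
have [v0|v0] := eqVneq (norm2 v) 0.
  rewrite v0 mulr0 norm2_0 // => i; rewrite big1 // => j _.
  by rewrite (norm2_eq0 v0) mulr0.
have vgt0 : 0 < norm2 v by rewrite lt0r v0 norm2_ge0.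
rewrite -ler_pdivrMr // mulrC -norm2Z ?invr_ge0 ?norm2_ge0 //.
apply: ub_le_sup; last first.
  exists (fun i => (norm2 v)^-1 * v i) => /=.
    by rewrite norm2Z ?invr_ge0 ?norm2_ge0 // mulVf.
  congr norm2; apply/funext => i; rewrite mulr_sumr.
  by apply: eq_bigr => j _; rewrite mulrCA.
(* [sup] dominates its set only once that set is known to be bounded. Entries of a vector in the
   unit ball are at most 1 in absolute value, so the absolute row sums give a bound. *)
exists (norm2 (fun i => \sum_j `|J i j|)) => _ [w /= w1 <-].
have wj j : `|w j| <= 1.
  rewrite -(ler_pXn2r (n := 2)) ?nnegrE // expr1n real_normK ?num_real //.
  apply: (@le_trans _ _ (norm2 w ^+ 2)).
    by rewrite sqr_norm2 (bigD1 j) //= lerDl sumr_ge0 // => i _; exact: sqr_ge0.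
  by rewrite expr_le1 // norm2_ge0.
rewrite /norm2 ler_wsqrtr //; apply: ler_sum => i _.
rewrite -[leLHS]real_normK ?num_real // lerXn2r ?nnegrE ?sumr_ge0 //.
apply: le_trans (ler_norm_sum _ _ _) _; apply: ler_sum => j _.
by rewrite normrM ler_piMr.
Qed.

(* Subtracting the midrange of h halves the oscillation, and costs nothing
   against weights of zero sum. *)
Definition midrange (T : finType) (t0 : T) (c : R) (h : T -> R) : R :=
  h [arg max_(t > t0) h t]%O - c / 2.

Lemma midrangeP (T : finType) (t0 : T) (c : R) (h : T -> R) :
  (forall a b, `|h a - h b| <= c) ->
  forall a, `|h a - midrange t0 c h| <= c / 2.
Proof.
move=> hc a; rewrite /midrange; case: arg_maxP => //= b _ /(_ a isT) /= hab.
have := hc b a; rewrite !ler_norml => /andP[h1 h2].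
by apply/andP; split; lra.
Qed.

(** Duality of total variation and oscillation: for [d] a difference of two probability vectors, the
    last factor is their [dTV]. *)
Lemma sum_zero_le_osc (T : finType) (d h : T -> R) (c : R) :
  \sum_a d a = 0 -> (forall a b, `|h a - h b| <= c) ->
  `|\sum_a d a * h a| <= c * (2^-1 * \sum_a `|d a|).
Proof.
move=> d0 hc; case: (pickP T) => [t0 _|T0]; last first.
  by rewrite !big_pred0 // !mulr0 normr0.
have -> : \sum_a d a * h a = \sum_a d a * (h a - midrange t0 c h).
  under [RHS]eq_bigr do rewrite mulrBr.
  by rewrite sumrB -mulr_suml d0 mul0r subr0.
apply: le_trans (ler_norm_sum _ _ _) _.
rewrite mulrA mulr_sumr; apply: ler_sum => a _.
by rewrite normrM mulrC ler_wpM2r // midrangeP.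
Qed.

(* Each |s a| is at most half of the l1 norm because the other entries sum to - s a. *)
Lemma sum_sqr_le_half_l1 (T : finType) (s : T -> R) : \sum_a s a = 0 ->
  \sum_a s a ^+ 2 <= 2 * (2^-1 * \sum_a `|s a|) ^+ 2.
Proof.
move=> s0; set t := 2^-1 * _.
have t2 : \sum_a `|s a| = 2 * t by rewrite /t; field.
have st a : `|s a| <= t.
  have : `|s a| <= \sum_(b | b != a) `|s b|.
    have -> : s a = - \sum_(b | b != a) s b.
      by apply/eqP; rewrite -addr_eq0; move: s0; rewrite (bigD1 a) //= => ->.
    by rewrite normrN ler_norm_sum.
  by move: t2; rewrite (bigD1 a) //=; lra.
have -> : 2 * t ^+ 2 = \sum_a `|s a| * t by rewrite -mulr_suml t2; ring.
apply: ler_sum => a _.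
by rewrite -[_ ^+ 2]real_normK ?num_real // expr2 ler_wpM2l.
Qed.

End FiniteSums.

(** * One-site updates and agreement classes of configurations *)

Section Configurations.
Context {X I : finType}.
Implicit Types (x y z w : {ffun I -> X}) (i j : I) (S : {set I}).

Definition upd z i a : {ffun I -> X} := [ffun j => if j == i then a else z j].

Lemma upd_eq z i a : upd z i a i = a.
Proof. by rewrite ffunE eqxx. Qed.

Lemma upd_neq z i a j : j != i -> upd z i a j = z j.
Proof. by rewrite ffunE => /negPf ->. Qed.

Lemma upd_id z i : upd z i (z i) = z.
Proof. by apply/ffunP => j; rewrite ffunE; case: eqP => [->|]. Qed.

Lemma upd_upd z i a b : upd (upd z i a) i b = upd z i b.
Proof. by apply/ffunP => j; rewrite !ffunE; case: eqP. Qed.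

Lemma agreeP S x y : reflect {in S, x =1 y} (agree S x y).
Proof. exact: 'forall_in_eqP. Qed.

Lemma agree_refl S x : agree S x x.
Proof. exact/agreeP. Qed.

Lemma agree_sym S x y : agree S x y = agree S y x.
Proof. by apply/agreeP/agreeP => xy j jS; rewrite xy. Qed.

Lemma agree_congr S x y z : agree S x y -> agree S z x = agree S z y.
Proof.
move=> /agreeP xy; apply/agreeP/agreeP => h j jS; rewrite h //; first exact: xy.
by rewrite xy.
Qed.

Lemma agree_upd S x z i a : i \notin S -> agree S (upd z i a) x = agree S z x.
Proof.
move=> iS; apply: eq_forallb_in => j jS; rewrite upd_neq //.
by apply: contraNneq iS => <-.
Qed.

Lemma agree_setC1 z i a : agree [set~ i]%SET (upd z i a) z.
Proof. by apply/agreeP => j; rewrite !inE => ji; rewrite upd_neq. Qed.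

Lemma agree_setC1_upd w z i : agree [set~ i]%SET w z -> w = upd z i (w i).
Proof.
move=> /agreeP wz; apply/ffunP => j; rewrite ffunE.
by case: eqVneq => [->//|ji]; rewrite wz // !inE.
Qed.

Lemma agree_setU1 S i w z :
  agree (i |: S) w z = agree S w z && (w i == z i).
Proof.
apply/agreeP/andP => [h|[/agreeP h /eqP wi] j].
  split; first by apply/agreeP => j jS; rewrite h // inE jS orbT.
  by rewrite h // setU11.
by rewrite !inE => /orP[/eqP ->//|]; exact: h.
Qed.

Lemma sum_agree_setC1 (V : nmodType) z i (F : {ffun I -> X} -> V) :
  \sum_(w | agree [set~ i]%SET w z) F w = \sum_a F (upd z i a).
Proof.
rewrite (reindex_onto (upd z i) (fun w => w i)) /=; last first.
  by move=> w /agree_setC1_upd.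
by apply: eq_bigl => a; rewrite agree_setC1 upd_eq eqxx.
Qed.

(** Exchanging the new value at [i] with the old one is an involution on pairs; this is the symmetry
    behind the self-adjointness of resampling. *)
Lemma sum_upd_swap (V : nmodType) i (F : {ffun I -> X} -> {ffun I -> X} -> V) :
  \sum_z \sum_a F z (upd z i a) = \sum_z \sum_a F (upd z i a) z.
Proof.
rewrite !pair_bigA /=.
pose h (p : {ffun I -> X} * X) := (upd p.1 i p.2, p.1 i).
have hK : involutive h.
  by case=> z a; rewrite /h /= upd_upd upd_id upd_eq.
rewrite (reindex_inj (inv_inj hK)) /=; apply: eq_bigr => -[z a] _ /=.
by rewrite upd_upd upd_id.
Qed.

End Configurations.

(** Heat-bath resampling of one site. Using a version [q] instead of [site_cond] keeps it a Markov
    operator even where the conditioning has zero mass. *)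
Definition site_avg (R : realType) (X I : finType)
    (q : I -> {ffun I -> X} -> X -> R) (i : I) (g : {ffun I -> X} -> R)
    (z : {ffun I -> X}) : R :=
  \sum_a q i z a * g (upd z i a).

Definition osc_le (R : realType) (X I : finType) (c : I -> R)
    (g : {ffun I -> X} -> R) : Prop :=
  forall j x y, agree [set~ j]%SET x y -> `|g x - g y| <= c j.

(** * Single-site resampling: self-adjointness and oscillation *)

Section Kernel.
Context {R : realType} {X I : finType} (mu : spin_system R X I).
Context (q : I -> {ffun I -> X} -> X -> R) (hq : is_cond_version mu q).
Implicit Types (x y z w : {ffun I -> X}) (i j : I) (S : {set I}).
Implicit Types (f g : {ffun I -> X} -> R).

Lemma marginal_setC1 z i : marginal mu [set~ i]%SET z = \sum_a mu (upd z i a).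
Proof. exact: sum_agree_setC1. Qed.

Lemma marginal_gt0 S z : 0 < mu z -> 0 < marginal mu S z.
Proof.
move=> z0; rewrite /marginal (bigD1 z) ?agree_refl //=.
by rewrite ltr_pwDl // sumr_ge0 // => w _; exact: mass_ge0.
Qed.

Lemma site_cond_upd z i a :
  site_cond mu i z a = mu (upd z i a) / \sum_b mu (upd z i b).
Proof.
rewrite /site_cond /cond_prob marginal_setC1; congr (_ / _).
rewrite (big_pred1 (upd z i a)) // => w /=; apply/andP/eqP => [[wz /eqP <-]|->].
  exact: agree_setC1_upd.
by rewrite agree_setC1 upd_eq.
Qed.

Lemma version_upd i z a b : q i (upd z i a) b = q i z b.
Proof. by case: hq => _ _ h _; rewrite (h _ _ z) // agree_setC1. Qed.

Lemma version_pos i z a : 0 < mu z ->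
  q i z a = mu (upd z i a) / \sum_b mu (upd z i b).
Proof.
move=> z0; rewrite -site_cond_upd; case: hq => _ _ _ -> //.
exact: marginal_gt0.
Qed.

Lemma site_avg_cst i c : site_avg q i (fun=> c) = fun=> c.
Proof.
by apply/funext => z; rewrite /site_avg -mulr_suml; case: hq => _ -> _ _; rewrite mul1r.
Qed.

Lemma site_avg_upd i g z a : site_avg q i g (upd z i a) = site_avg q i g z.
Proof. by apply: eq_bigr => b _; rewrite version_upd upd_upd. Qed.

Lemma site_avg_off i g : (forall z a, g (upd z i a) = g z) -> site_avg q i g = g.
Proof.
move=> hg; apply/funext => z; rewrite /site_avg.
under eq_bigr do rewrite hg.
by rewrite -mulr_suml; case: hq => _ -> _ _; rewrite mul1r.
Qed.

Lemma site_avg_gt0 i f z : (forall w, 0 < f w) -> 0 < site_avg q i f z.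
Proof.
move=> f0; case: hq => q0 q1 _ _; rewrite lt0r; apply/andP; split; last first.
  by apply: sumr_ge0 => a _; rewrite mulr_ge0 // ltW.
apply/eqP => /eqP; rewrite psumr_eq0 => [/allP h|a _]; last first.
  by rewrite mulr_ge0 // ltW.
have /eqP := q1 i z; rewrite big1 ?eqr01 // => [|a _]; first by rewrite eq_sym oner_eq0.
have := h a; rewrite mem_index_enum => /(_ isT).
by rewrite mulf_eq0 [f _ == 0]gt_eqF // orbF => /eqP.
Qed.

(** Detailed balance: the weight [mu z * mu w / m z], with [m z] the mass of the fibre through [z]
    at site [i], is symmetric in [z] and its update [w]. As [i] lies outside [S], updates stay in
    the agreement class, so the symmetry survives conditioning on [S]. *)
Lemma site_avg_selfadjoint S x i f g : i \notin S ->
  \sum_(z | agree S z x) mu z * (site_avg q i f z * g z) =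
  \sum_(z | agree S z x) mu z * (f z * site_avg q i g z).
Proof.
move=> iS; rewrite [LHS]big_mkcond [RHS]big_mkcond /=.
pose m z := \sum_b mu (upd z i b).
have mU z a : m (upd z i a) = m z by apply: eq_bigr => b _; rewrite upd_upd.
pose F (f g : {ffun I -> X} -> R) z w :=
  (if agree S z x then mu z * mu w / m z * (f w * g z) else 0).
have E (u v : {ffun I -> X} -> R) z :
  (if agree S z x then mu z * (site_avg q i u z * v z) else 0) =
  \sum_a F u v z (upd z i a).
  rewrite /F; case: ifP => _; last by rewrite big1.
  (* At a zero-mass [z] the version [q] need not be given by [mu], but the weight [mu z] removes the
     term. *)
  have [->|z0] := eqVneq (mu z) 0.
    by rewrite mul0r big1 // => a _; rewrite !mul0r.
  rewrite /site_avg mulr_suml mulr_sumr; apply: eq_bigr => a _.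
  by rewrite version_pos ?lt0r ?z0 ?mass_ge0 // -/(m z); ring.
under eq_bigr do rewrite E.
rewrite sum_upd_swap; apply: eq_bigr => z _.
have -> : (if agree S z x then mu z * (f z * site_avg q i g z) else 0) =
  \sum_a F g f z (upd z i a).
  by rewrite -E; case: ifP => // _; rewrite [f z * _]mulrC.
by apply: eq_bigr => a _; rewrite /F agree_upd // mU; case: ifP => // _; ring.
Qed.

Lemma sum_site_avg S x i f : i \notin S ->
  \sum_(z | agree S z x) mu z * site_avg q i f z =
  \sum_(z | agree S z x) mu z * f z.
Proof.
move=> iS; have := site_avg_selfadjoint x f (fun=> 1) iS.
rewrite site_avg_cst.
by under eq_bigr do rewrite mulr1; under [in RHS]eq_bigr do rewrite mulr1.
Qed.

(** Changing site [j] acts twice: on the integrand, by at most [c j], and on the averaging law at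
    [i], by at most [J i j] in total variation, tested on a function of the value at [i] with
    oscillation [c i]. The average itself does not depend on site [i]. *)
Lemma osc_le_site_avg (J : I -> I -> R) (c : I -> R) g i :
  (forall i j x y, agree [set~ j]%SET x y -> dTV (q i x) (q i y) <= J i j) ->
  osc_le c g ->
  osc_le (fun j => if j == i then 0 else c j + J i j * c i) (site_avg q i g).
Proof.
move=> hJ gc j x y xy; case: hq => q0 q1 qoff _.
have [ji|ji] := eqVneq j i.
  rewrite ji in xy; rewrite (agree_setC1_upd xy) site_avg_upd.
  by rewrite subrr normr0.
have -> : site_avg q i g x - site_avg q i g y =
  \sum_a q i x a * (g (upd x i a) - g (upd y i a)) +
  \sum_a (q i x a - q i y a) * g (upd y i a).
  rewrite -sumrB -big_split /=; apply: eq_bigr => a _; ring.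
apply: le_trans (ler_normD _ _) _; apply: lerD.
  apply: le_trans (ler_norm_sum _ _ _) _.
  rewrite -[leRHS]mul1r -(q1 i x) mulr_suml; apply: ler_sum => a _.
  rewrite normrM ger0_norm // ler_wpM2l // gc //.
  apply/agreeP => k kj; rewrite !ffunE; case: eqP => // _.
  exact: (agreeP _ _ _ xy).
apply: le_trans (sum_zero_le_osc (c := c i) _ _) _.
- by rewrite sumrB !q1 subrr.
- by move=> a b; apply: gc; apply/agreeP => k; rewrite !inE => ki; rewrite !upd_neq.
- rewrite mulrC ler_wpM2r //; last exact: hJ.
  by apply: le_trans (gc i x x (agree_refl _ _)); rewrite normr_ge0.
Qed.

End Kernel.

(** * Dobrushin's comparison between the conditional laws of f mu and mu *)

Section DobrushinComparison.
Context {R : realType} {X I : finType} (mu : spin_system R X I).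
Context (q : I -> {ffun I -> X} -> X -> R) (hq : is_cond_version mu q).
Context (J : I -> I -> R).
Hypothesis hJ : forall i j x y,
  agree [set~ j]%SET x y -> dTV (q i x) (q i y) <= J i j.
Hypothesis J0 : forall i, J i i = 0.
Context (S : {set I}) (x : {ffun I -> X}) (f : {ffun I -> X} -> R) (r : R).
Implicit Types (y z w : {ffun I -> X}) (i j : I).
Implicit Types (g : {ffun I -> X} -> R) (a c : I -> R).

(* Integration against mu (f - r) on the configurations agreeing with x on S:
   when r is the conditional mean of f, this is a multiple of the difference
   between the conditional laws of f mu and of mu. *)
Definition tilt g : R := \sum_(z | agree S z x) mu z * ((f z - r) * g z).

(** For positive [f], the ratio [f / site_avg q i f] is the density of the single-site law of f mu
    against that of mu. This is thus their total variation distance averaged over f mu, on the class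
    of [x] and without normalization. *)
Definition local_defect i : R :=
  2^-1 * \sum_(z | agree S z x) mu z * `|f z - site_avg q i f z|.

Definition is_estimate a : Prop :=
  forall g c, osc_le c g -> `|tilt g| <= \sum_j a j * c j.

Lemma local_defect_ge0 i : 0 <= local_defect i.
Proof.
by rewrite mulr_ge0 ?invr_ge0 // sumr_ge0 // => z _; rewrite mulr_ge0 ?mass_ge0.
Qed.

Lemma interdependence_ge0 i j : 0 <= J i j.
Proof.
apply: le_trans (hJ i (agree_refl [set~ j]%SET x)).
by rewrite mulr_ge0 ?invr_ge0 // sumr_ge0.
Qed.

(** Self-adjointness moves the resampling from [g] to [f]. The difference [f - site_avg q i f] is
    orthogonal to functions independent of site [i], so [g] may be centred at its midrange [m] along
    that site, which leaves a factor [c i / 2]. *)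
Lemma tilt_site_defect g c i : i \notin S -> osc_le c g ->
  `|tilt (fun z => g z - site_avg q i g z)| <= local_defect i * c i.
Proof.
move=> iS gc.
pose m z := midrange (x i) (c i) (fun u => g (upd z i u)).
have mU z u : m (upd z i u) = m z.
  by rewrite /m; congr midrange; apply/funext => b; rewrite upd_upd.
have gm z : `|g z - m z| <= c i / 2.
  rewrite -{1}(upd_id z i); apply: midrangeP => a b; apply: gc.
  by apply/agreeP => k; rewrite !inE => ki; rewrite !upd_neq.
have -> : tilt (fun z => g z - site_avg q i g z) =
  \sum_(z | agree S z x) mu z * ((f z - site_avg q i f z) * (g z - m z)).
  have e1 := site_avg_selfadjoint hq x f g iS.
  have e2 := site_avg_selfadjoint hq x f m iS.
  have e3 := sum_site_avg hq x g iS.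
  rewrite (site_avg_off hq mU) in e2.
  transitivity (\sum_(z | agree S z x) mu z * (f z * g z) -
    \sum_(z | agree S z x) mu z * (f z * site_avg q i g z) -
    r * (\sum_(z | agree S z x) mu z * g z -
      \sum_(z | agree S z x) mu z * site_avg q i g z)).
    rewrite -!sumrB mulr_sumr -sumrB; apply: eq_bigr => z _; ring.
  rewrite e3 subrr mulr0 subr0 -e1 -sumrB.
  transitivity (\sum_(z | agree S z x) mu z * (f z * g z) -
    \sum_(z | agree S z x) mu z * (site_avg q i f z * g z) -
    (\sum_(z | agree S z x) mu z * (f z * m z) -
    \sum_(z | agree S z x) mu z * (site_avg q i f z * m z))).
    by rewrite e2 subrr subr0 -sumrB.
  rewrite -!sumrB; apply: eq_bigr => z _; ring.
apply: le_trans (ler_norm_sum _ _ _) _.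
rewrite /local_defect mulrAC mulrC mulr_suml; apply: ler_sum => z _.
rewrite !normrM (ger0_norm (mass_ge0 _ _)) -mulrA ler_wpM2l ?mass_ge0 //.
by rewrite mulrC [in leRHS]mulrC ler_wpM2l // mulrC.
Qed.

(** Resample site [i] first. The average has no oscillation at [i], so [a i] drops out; its extra
    oscillation [J i k * c i] at each [k] is charged to [c i], and the resampling error adds the
    local defect. *)
Lemma estimate_update a i : i \notin S -> (forall j, 0 <= a j) ->
  is_estimate a ->
  is_estimate (fun j => if j == i then local_defect i + \sum_k J i k * a k else a j).
Proof.
move=> iS a0 ha g c gc.
have -> : tilt g = tilt (site_avg q i g) + tilt (fun z => g z - site_avg q i g z).
  by rewrite /tilt -big_split /=; apply: eq_bigr => z _; ring.
apply: le_trans (ler_normD _ _) _.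
have h1 := ha _ _ (osc_le_site_avg hq i hJ gc).
apply: le_trans (lerD h1 (tilt_site_defect iS gc)) _.
rewrite (bigD1 i) //= eqxx mulr0 add0r [leRHS](bigD1 i) //= eqxx.
have -> : \sum_(k | k != i) a k * (if k == i then 0 else c k + J i k * c i) =
  \sum_(k | k != i) a k * c k + c i * \sum_(k | k != i) J i k * a k.
  rewrite mulr_sumr -big_split /=; apply: eq_bigr => k /negPf ->; ring.
rewrite [\sum_k J i k * a k](bigD1 i) //= J0 mul0r add0r.
rewrite [X in _ <= _ + X](eq_bigr (fun k => a k * c k)); last first.
  by move=> k /negPf ->.
by rewrite le_eqVlt; apply/orP; left; apply/eqP; ring.
Qed.

(** Telescoping through hybrids that pass from [x] to [z] one site at a time; the sites of [S] need
    no change. *)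
Lemma osc_le_path g c z : osc_le c g -> agree S z x ->
  `|g z - g x| <= \sum_(j | j \notin S) c j.
Proof.
move=> gc zx.
pose hyb (s : seq I) : {ffun I -> X} := [ffun j => if j \in s then z j else x j].
have H s : uniq s -> `|g (hyb s) - g x| <= \sum_(j <- s) c j.
  elim: s => [_|k s IH /= /andP[ks us]].
    have -> : hyb [::] = x by apply/ffunP => j; rewrite ffunE.
    by rewrite subrr normr0 big_nil.
  rewrite big_cons -(subrK (g (hyb s)) (g (hyb (k :: s)))) -addrA.
  apply: le_trans (ler_normD _ _) _; apply: lerD (IH us).
  apply: gc; apply/agreeP => j; rewrite !inE => jk.
  by rewrite !ffunE inE (negPf jk).
have -> : z = hyb (enum [pred j | j \notin S]).
  apply/ffunP => j; rewrite ffunE mem_enum inE.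
  by case: (boolP (j \in S)) => //= jS; rewrite (agreeP _ _ _ zx).
by rewrite -[leRHS]big_enum; apply: H; exact: enum_uniq.
Qed.

(* An almost minimal estimate is almost a fixed point of the one-site updates. *)
Lemma exists_estimate (e : R) : tilt (fun=> 1) = 0 -> 0 < e ->
  exists a, [/\ is_estimate a, forall j, 0 <= a j &
    forall i, a i <= (if i \in S then 0 else local_defect i) +
      \sum_j J i j * a j + e].
Proof.
move=> t0 e0.
pose A := [set s : R | exists a, [/\ is_estimate a, forall j, 0 <= a j,
  forall j, j \in S -> a j = 0 & \sum_j a j = s]].
have Alb : has_lbound A.
  by exists 0 => _ [a [_ a0 _ <-]]; exact: sumr_ge0.
have A0 : A !=set0.
  (* A crude admissible vector: [B] at each site off [S]. It works because [tilt] kills constants,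
     so [g] can be replaced by its deviation from [g x]. *)
  pose B := \sum_(z | agree S z x) mu z * `|f z - r|.
  have B0 : 0 <= B by apply: sumr_ge0 => z _; rewrite mulr_ge0 ?mass_ge0.
  eexists; exists (fun j => if j \in S then 0 else B); split; last by [].
  - move=> g c gc.
    have -> : tilt g = tilt (fun z => g z - g x).
      apply/eqP; rewrite -subr_eq0; apply/eqP.
      rewrite -[RHS](mulr0 (g x)) -{}t0 /tilt mulr_sumr -sumrB.
      apply: eq_bigr => z _; ring.
    apply: le_trans (ler_norm_sum _ _ _) _.
    apply: (@le_trans _ _ (B * \sum_(j | j \notin S) c j)); last first.
      rewrite mulr_sumr big_mkcond /=; apply: ler_sum => j _.
      by case: (j \in S) => //=; rewrite mul0r.
    rewrite mulr_suml; apply: ler_sum => z zx.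
    rewrite !normrM (ger0_norm (mass_ge0 _ _)) -mulrA ler_wpM2l ?mass_ge0 //.
    by rewrite ler_wpM2l // osc_le_path.
  - by move=> j; case: ifP.
  - by move=> j ->.
have [_ [a [ha a0 aS <-]] lta] := inf_adherent e0 (conj A0 Alb).
exists a; split=> // i.
have Ja0 : 0 <= \sum_j J i j * a j.
  by apply: sumr_ge0 => j _; rewrite mulr_ge0 ?interdependence_ge0.
case: ifPn => iS; first by rewrite aS // add0r addr_ge0 // ltW.
set b := local_defect i + _.
have b0 : 0 <= b by rewrite addr_ge0 // local_defect_ge0.
(* Replacing [a i] by [b] again gives an admissible estimate, whose total cannot fall below the
   infimum; as [a] is within [e] of it, [a i] exceeds [b] by at most [e]. *)
have : inf A <= \sum_j (if j == i then b else a j).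
  apply: ge_inf => //; exists (fun j => if j == i then b else a j); split => //.
  - exact: estimate_update.
  - by move=> j; case: ifP.
  - by move=> j jS; case: eqP => [ji|_]; [rewrite -ji jS in iS|exact: aS].
rewrite (bigD1 i) //= eqxx.
rewrite (eq_bigr a) => [|k /negPf -> //].
by move: lta; rewrite (bigD1 i) //=; lra.
Qed.

(** With [r] the conditional mean of [f], a multiple of the difference between the laws of the
    coordinate at [i] under f mu and mu, given the coordinates in [S]. *)
Definition tilt_marginal i (u : X) : R :=
  \sum_(z | agree S z x && (z i == u)) mu z * (f z - r).

Lemma sum_tilt_marginal i (h : X -> R) :
  \sum_u tilt_marginal i u * h u = tilt (fun z => h (z i)).
Proof.
rewrite /tilt (partition_big (fun z => z i) xpredT) //=.
apply: eq_bigr => u _; rewrite mulr_suml; apply: eq_bigr => z /andP[_ /eqP <-].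
by rewrite mulrA.
Qed.

(** The estimate is tested on half the sign of the tilted marginal, a function of the coordinate at
    [i] alone with oscillation at most 1. *)
Lemma tilt_marginal_l1_le a i : is_estimate a ->
  2^-1 * \sum_u `|tilt_marginal i u| <= a i.
Proof.
move=> ha.
pose h u := Num.sg (tilt_marginal i u) / 2.
have -> : 2^-1 * \sum_u `|tilt_marginal i u| = tilt (fun z => h (z i)).
  rewrite -sum_tilt_marginal mulr_sumr; apply: eq_bigr => u _.
  by rewrite /h normrEsg; ring.
apply: le_trans (ler_norm _) _.
apply: le_trans (ha _ (fun j => (j == i)%:R) _) _; last first.
  rewrite (bigD1 i) //= eqxx mulr1 big1 ?addr0 // => j /negPf ->.
  by rewrite mulr0.
move=> j y z yz; case: eqVneq => [ji|ji]; last first.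
  by rewrite (agreeP _ _ _ yz) ?subrr ?normr0 // !inE eq_sym.
rewrite /h -mulrBl normrM [`|2^-1|]ger0_norm ?invr_ge0 // ler_pdivrMr // mul1r.
apply: le_trans (ler_normB _ _) _; rewrite !normr_sg.
by case: (_ != 0); case: (_ != 0) => /=; lra.
Qed.

Lemma tilt_marginal_l2_le (a2 : R) : tilt (fun=> 1) = 0 ->
  0 < a2 -> opnorm2 J <= 1 - a2 ->
  a2 ^+ 2 * \sum_i (2^-1 * \sum_u `|tilt_marginal i u|) ^+ 2 <=
  \sum_(i | i \notin S) local_defect i ^+ 2.
Proof.
move=> t0 a20 hJ2.
pose tau i := 2^-1 * \sum_u `|tilt_marginal i u|.
pose d i := if i \in S then 0 else local_defect i.
have -> : \sum_(i | i \notin S) local_defect i ^+ 2 = norm2 d ^+ 2.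
  rewrite sqr_norm2 big_mkcond; apply: eq_bigr => i _ /=.
  by rewrite /d; case: (i \in S); rewrite /= ?expr0n.
rewrite -[\sum_i _]/(\sum_i tau i ^+ 2) -sqr_norm2 -exprMn.
rewrite ler_pXn2r ?nnegrE ?mulr_ge0 ?norm2_ge0 ?(ltW a20) //.
apply/ler_addgt0Pr => e e0.
(* An error [e / N] at every site has Euclidean norm at most [e]; the added 1 keeps [N] positive
   even for empty [I]. *)
pose N := norm2 (fun _ : I => 1 : R) + 1.
have N0 : 0 < N by rewrite ltr_wpDl // norm2_ge0.
have eN : 0 < e / N by rewrite divr_gt0.
have [a [ha a0 le_a]] := exists_estimate t0 eN.
have aJ : norm2 a <= norm2 d + (1 - a2) * norm2 a + e.
  apply: (@le_trans _ _ (norm2 (fun i => d i + \sum_j J i j * a j + e / N * 1))).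
    by apply: le_norm2 => i; rewrite a0 /= mulr1; exact: le_a.
  apply: le_trans (norm2D _ _) _; apply: lerD; last first.
    rewrite norm2Z; last exact: ltW.
    by rewrite mulrAC -mulrA ler_piMr ?ltW // ltr_pdivrMr // mul1r /N ltrDl.
  apply: le_trans (norm2D _ _) _; apply: lerD => //.
  apply: le_trans (norm2_mulmx_le _ _) _.
  by rewrite ler_wpM2r ?norm2_ge0.
apply: (@le_trans _ _ (a2 * norm2 a)); last by lra.
rewrite ler_wpM2l ?(ltW a20) //; apply: le_norm2 => i.
rewrite mulr_ge0 ?invr_ge0 ?sumr_ge0 //=; exact: tilt_marginal_l1_le.
Qed.

End DobrushinComparison.

(** * Logarithmic inequalities and a weighted Cauchy-Schwarz inequality *)

Section RealInequalities.
Context {R : realType}.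
Implicit Types a b u r : R.

Lemma ln_le_subr1 a : 0 < a -> ln a <= a - 1.
Proof. by move=> a0; rewrite -{1}(subrK 1 a) addrC; apply: le_ln1Dx; lra. Qed.

Lemma sub_div_le_ln a b : 0 < a -> 0 < b -> (a - b) / a <= ln a - ln b.
Proof.
move=> a0 b0; have := ln_le_subr1 (divr_gt0 b0 a0).
rewrite ln_div ?posrE // mulrBl divff ?gt_eqF //; lra.
Qed.

(** Pointwise core of the Pinsker-type bound. By symmetry [b <= a]; the tangent bound on [ln] then
    gives the stronger denominator [a]. *)
Lemma sqr_sub_div_le_ln a b : 0 < a -> 0 < b ->
  (a - b) ^+ 2 / (a + b) <= (a - b) * (ln a - ln b).
Proof.
wlog ab : a b / b <= a => [hw a0 b0|a0 b0].
  have [ba|/ltW ab] := leP b a; first exact: hw.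
  have := hw _ _ ab b0 a0; rewrite [b + a]addrC -sqrrN opprB => /le_trans; apply.
  by rewrite le_eqVlt; apply/orP; left; apply/eqP; ring.
apply: le_trans (ler_wpM2l _ (sub_div_le_ln a0 b0)); last by rewrite subr_ge0.
rewrite mulrA -expr2 ler_wpM2l ?sqr_ge0 // lef_pV2 ?posrE ?addr_gt0 //.
by rewrite lerDl ltW.
Qed.

(* The Taylor bound behind the comparison of entropy with chi-square. *)
Lemma xlnx_sub_le u r : 0 < u -> 0 < r ->
  u * ln u - r * ln r <= (ln r + 1) * (u - r) + (u - r) ^+ 2 / r.
Proof.
move=> u0 r0; have := sub_div_le_ln r0 u0; rewrite -lerN2 => h.
have {h} := ler_wpM2l (ltW u0) h.
have -> : u * - ((r - u) / r) = (u - r) + (u - r) ^+ 2 / r.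
  by field; rewrite gt_eqF.
lra.
Qed.

Lemma weighted_cauchy_schwarz (T : finType) (P : pred T) (m d s : T -> R) :
  (forall z, 0 <= m z) -> (forall z, 0 < s z) ->
  0 < \sum_(z | P z) m z * s z ->
  (\sum_(z | P z) m z * `|d z|) ^+ 2 <=
  (\sum_(z | P z) m z * (d z ^+ 2 / s z)) * \sum_(z | P z) m z * s z.
Proof.
move=> m0 s0; set D := \sum_(z | P z) m z * `|d z|.
set A := \sum_(z | P z) m z * (d z ^+ 2 / s z); set B := \sum_(z | P z) m z * s z.
(* This [t] minimizes the nonnegative quadratic [A - 2 * t * D + t ^+ 2 * B]. *)
move=> B0; pose t := D / B.
have : 2 * t * D <= A + t ^+ 2 * B.
  rewrite !mulr_sumr -big_split /=; apply: ler_sum => z _.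
  rewrite mulrCA [t ^+ 2 * _]mulrCA -mulrDr ler_wpM2l //.
  rewrite -(ler_pM2r (s0 z)) [leRHS]mulrDl divfK ?gt_eqF //.
  rewrite -[d z ^+ 2]real_normK ?num_real // -subr_ge0.
  have -> : `|d z| ^+ 2 + t ^+ 2 * s z * s z - 2 * t * `|d z| * s z =
    (`|d z| - t * s z) ^+ 2 by ring.
  exact: sqr_ge0.
rewrite -ler_pdivrMr //.
have -> : 2 * t * D = 2 * (D ^+ 2 / B) by rewrite /t; ring.
have -> : t ^+ 2 * B = D ^+ 2 / B by rewrite /t; field; rewrite gt_eqF.
lra.
Qed.

End RealInequalities.

(** * Factorization of entropy along the revelation of coordinates *)

Definition cond_mean (R : realType) (X I : finType) (mu : spin_system R X I)
    (S : {set I}) (f : {ffun I -> X} -> R) (x : {ffun I -> X}) : R :=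
  (\sum_(z | agree S z x) mu z * f z) / marginal mu S x.

Section EntropyFactorization.
Context {R : realType} {X I : finType} (mu : spin_system R X I).
Implicit Types (x y z w : {ffun I -> X}) (i j : I) (S : {set I}).
Implicit Types (f g psi : {ffun I -> X} -> R).

Lemma eq_mass_sum f g : (forall z, 0 < mu z -> f z = g z) ->
  \sum_z mu z * f z = \sum_z mu z * g z.
Proof.
move=> fg; apply: eq_bigr => z _.
have [->|z0] := eqVneq (mu z) 0; first by rewrite !mul0r.
by rewrite fg // lt0r z0 mass_ge0.
Qed.

Lemma le_mass_sum (P : pred {ffun I -> X}) f g :
  (forall z, P z -> 0 < mu z -> f z <= g z) ->
  \sum_(z | P z) mu z * f z <= \sum_(z | P z) mu z * g z.
Proof.
move=> fg; apply: ler_sum => z Pz.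
have [->|z0] := eqVneq (mu z) 0; first by rewrite !mul0r.
by rewrite ler_wpM2l ?mass_ge0 // fg // lt0r z0 mass_ge0.
Qed.

Lemma mean_gt0 S f x : (forall z, 0 < f z) -> 0 < mu x ->
  0 < \sum_(z | agree S z x) mu z * f z.
Proof.
move=> f0 x0; rewrite (bigD1 x) ?agree_refl //= ltr_pwDl ?mulr_gt0 //.
by apply: sumr_ge0 => z _; rewrite mulr_ge0 ?mass_ge0 // ltW.
Qed.

Lemma cond_mean_gt0 S f x : (forall z, 0 < f z) -> 0 < mu x ->
  0 < cond_mean mu S f x.
Proof. by move=> f0 x0; rewrite divr_gt0 ?mean_gt0 ?marginal_gt0. Qed.

Lemma eq_agree_sum S x y (F : {ffun I -> X} -> R) : agree S x y ->
  \sum_(z | agree S z x) F z = \sum_(z | agree S z y) F z.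
Proof. by move=> xy; apply: eq_bigl => z; exact: agree_congr. Qed.

Lemma eq_marginal S x y : agree S x y -> marginal mu S x = marginal mu S y.
Proof. exact: eq_agree_sum. Qed.

Lemma eq_cond_mean S f x y : agree S x y -> cond_mean mu S f x = cond_mean mu S f y.
Proof. by move=> xy; rewrite /cond_mean (eq_agree_sum _ xy) (eq_marginal xy). Qed.

(** Tower property: after exchanging the sums, the weights [mu z / marginal mu S w] over the class
    of [w] add up to 1. A zero-mass [w] contributes nothing, even if its marginal vanishes. *)
Lemma sum_cond_mean S psi f : (forall z w, agree S z w -> psi z = psi w) ->
  \sum_z mu z * (psi z * cond_mean mu S f z) = \sum_z mu z * (psi z * f z).
Proof.
move=> hpsi.
transitivity (\sum_z \sum_(w | agree S w z)
   mu w * (psi w * f w) * (mu z / marginal mu S w)).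
  apply: eq_bigr => z _; rewrite /cond_mean mulr_suml !mulr_sumr.
  apply: eq_bigr => w wz; rewrite (hpsi _ _ wz) (eq_marginal wz); ring.
rewrite (exchange_big_dep xpredT) //=; apply: eq_bigr => w _.
rewrite -mulr_sumr -mulr_suml.
have [->|w0] := eqVneq (mu w) 0; first by rewrite !mul0r.
have -> : \sum_(z | agree S w z) mu z = marginal mu S w.
  by apply: eq_bigl => z; rewrite agree_sym.
by rewrite divff ?mulr1 // gt_eqF // marginal_gt0 // lt0r w0 mass_ge0.
Qed.

Lemma marginal0 x : marginal mu finset.set0 x = 1.
Proof.
rewrite /marginal -(mass_sum1 mu); apply: eq_bigl => z.
by apply/agreeP => j; rewrite inE.
Qed.

Lemma marginalT x : marginal mu [set: I]%SET x = mu x.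
Proof.
rewrite /marginal (big_pred1 x) // => z; apply/agreeP/eqP => [zx|-> //].
by apply/ffunP => j; rewrite zx // inE.
Qed.

(** Interpolates between the two terms of the entropy: the full set gives the mean of f ln f, the
    empty set gives m ln m for the mean m. Entropy is therefore the total increment as coordinates
    are revealed. *)
Definition mean_xlnx f S : R :=
  \sum_z mu z * (cond_mean mu S f z * ln (cond_mean mu S f z)).

Lemma mean_xlnxT f : mean_xlnx f [set: I]%SET = \sum_z mu z * (f z * ln (f z)).
Proof.
apply: eq_mass_sum => z z0.
suff -> : cond_mean mu [set: I]%SET f z = f z by [].
rewrite /cond_mean marginalT (big_pred1 z) => [|w]; last first.
  apply/agreeP/eqP => [wz|-> //].
  by apply/ffunP => j; rewrite wz // inE.
by rewrite mulrAC divff ?mul1r // gt_eqF.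
Qed.

Lemma mean_xlnx0 f : mean_xlnx f finset.set0 =
  (\sum_z mu z * f z) * ln (\sum_z mu z * f z).
Proof.
rewrite /mean_xlnx.
have E z : cond_mean mu finset.set0 f z = \sum_z mu z * f z.
  rewrite /cond_mean marginal0 divr1; apply: eq_bigl => w.
  by apply/agreeP => j; rewrite inE.
by under eq_bigr do rewrite E; rewrite -mulr_suml mass_sum1 mul1r.
Qed.

(* The first-order Taylor term vanishes by the tower property. *)
Lemma mean_xlnx_setU1_le f S i : (forall z, 0 < f z) ->
  mean_xlnx f (i |: S) - mean_xlnx f S <=
  \sum_z mu z * ((cond_mean mu (i |: S) f z - cond_mean mu S f z) ^+ 2
                 / cond_mean mu S f z).
Proof.
move=> f0; rewrite /mean_xlnx.
set u := cond_mean mu (i |: S) f; set r := cond_mean mu S f.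
have rP z w : agree S z w -> ln (r z) + 1 = ln (r w) + 1.
  by move=> zw; rewrite /r (eq_cond_mean f zw).
have rU z w : agree (i |: S) z w -> ln (r z) + 1 = ln (r w) + 1.
  by rewrite agree_setU1 => /andP[zw _]; exact: rP.
have h0 : \sum_z mu z * ((ln (r z) + 1) * (u z - r z)) = 0.
  under eq_bigr do rewrite mulrBr mulrBr.
  by rewrite sumrB (sum_cond_mean f rP) (sum_cond_mean f rU) subrr.
rewrite -[leRHS]add0r -[X in _ <= X + _]h0 -big_split -sumrB /=.
rewrite (eq_bigr (fun z => mu z * (u z * ln (u z) - r z * ln (r z)))); last first.
  by move=> z _; rewrite mulrBr.
rewrite [leRHS](eq_bigr (fun z => mu z * ((ln (r z) + 1) * (u z - r z) +
  (u z - r z) ^+ 2 / r z))); last by move=> z _; rewrite -mulrDr.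
by apply: le_mass_sum => z _ z0; apply: xlnx_sub_le; exact: cond_mean_gt0.
Qed.

Context (q : I -> {ffun I -> X} -> X -> R) (hq : is_cond_version mu q).
Context (J : I -> I -> R).
Hypothesis hJ : forall i j x y,
  agree [set~ j]%SET x y -> dTV (q i x) (q i y) <= J i j.
Hypothesis J0 : forall i, J i i = 0.
Context (a1 a2 : R) (f : {ffun I -> X} -> R).
Hypothesis a1_gt0 : 0 < a1.
Hypothesis a2_gt0 : 0 < a2.
Hypothesis hJ2 : opnorm2 J <= 1 - a2.
Hypothesis hb : forall S i z, i \notin S -> 0 < mu z ->
  a1 * marginal mu S z <= marginal mu (i |: S) z.
Hypothesis f_gt0 : forall z, 0 < f z.

(** Integrand of the [i]-th term of the Dirichlet form of [f] and [ln f], with the resampling moved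
    onto [f] by self-adjointness. *)
Definition site_dirichlet i z : R := (f z - site_avg q i f z) * ln (f z).

(** Cauchy-Schwarz with weight [f + w], of total mass twice that of [f] by invariance, then the
    pointwise bound by [(f - w) * (ln f - ln w)]. The [ln w] part integrates to zero since [w] does
    not depend on site [i]. *)
Lemma sqr_local_defect_le S x i : i \notin S -> 0 < mu x ->
  local_defect mu q S x f i ^+ 2 <=
  (\sum_(z | agree S z x) mu z * f z) / 2 *
  \sum_(z | agree S z x) mu z * site_dirichlet i z.
Proof.
move=> iS x0; set w := site_avg q i f.
have w0 z : 0 < w z by exact: (site_avg_gt0 hq).
pose s z := f z + w z.
have s0 z : 0 < s z by rewrite addr_gt0.
have es : \sum_(z | agree S z x) mu z * s z =
    2 * \sum_(z | agree S z x) mu z * f z.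
  under eq_bigr do rewrite mulrDr.
  by rewrite big_split /= (sum_site_avg hq x f iS); ring.
have sum_s : 0 < \sum_(z | agree S z x) mu z * s z by exact: mean_gt0.
have := weighted_cauchy_schwarz (fun z => f z - w z) (mass_ge0 mu) s0 sum_s.
rewrite es => h; rewrite /local_defect -/w exprMn.
have : \sum_(z | agree S z x) mu z * ((f z - w z) ^+ 2 / s z) <=
    \sum_(z | agree S z x) mu z * site_dirichlet i z.
  apply: (@le_trans _ _ (\sum_(z | agree S z x)
      mu z * ((f z - w z) * (ln (f z) - ln (w z))))).
    by apply: le_mass_sum => z _ _; exact: sqr_sub_div_le_ln.
  have e0 : \sum_(z | agree S z x) mu z * (w z * ln (w z)) =
      \sum_(z | agree S z x) mu z * (f z * ln (w z)).
    rewrite (site_avg_selfadjoint hq x f (fun z => ln (w z)) iS).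
    have -> // : site_avg q i (fun z => ln (w z)) = fun z => ln (w z).
    by apply: (site_avg_off hq) => z a; rewrite /w (site_avg_upd hq).
  rewrite (eq_bigr (fun z => mu z * site_dirichlet i z -
      (mu z * (f z * ln (w z)) - mu z * (w z * ln (w z))))); last first.
    by move=> z _; rewrite /site_dirichlet -/w; ring.
  by rewrite sumrB sumrB e0 subrr subr0.
have F0 : 0 < \sum_(z | agree S z x) mu z * f z by exact: mean_gt0.
move=> /(ler_wpM2r (ltW F0)); nra.
Qed.

(** Where the value at [i] is [u], the increment of the conditional mean is the tilted marginal
    divided by the fibre mass [m u]. The constant comes from [a1 * M <= m u] and [F = r * M]. *)
Lemma chi2_le_tilt_marginal S x i : i \notin S -> 0 < mu x ->
  let r := cond_mean mu S f x in
  \sum_(z | agree S z x) mu z * ((cond_mean mu (i |: S) f z - r) ^+ 2 / r) <=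
  (a1 * \sum_(z | agree S z x) mu z * f z)^-1 *
    \sum_u tilt_marginal mu S x f r i u ^+ 2.
Proof.
move=> iS x0 /=; set r := cond_mean mu S f x; set F := \sum_(z | agree S z x) mu z * f z; set M := marginal mu S x.
have F0 : 0 < F by exact: mean_gt0.
have M0 : 0 < M by exact: marginal_gt0.
have r0 : 0 < r by exact: cond_mean_gt0.
have FE : F = r * M by rewrite /r /cond_mean -/M -/F divfK ?gt_eqF.
clearbody r F; pose s u := tilt_marginal mu S x f r i u.
pose m u := \sum_(z | agree S z x && (z i == u)) mu z.
have m0 u : 0 <= m u by apply: sumr_ge0 => z _; exact: mass_ge0.
have sumE (G : {ffun I -> X} -> R) z : agree S z x ->
    \sum_(w | agree (i |: S) w z) G w =
    \sum_(w | agree S w x && (w i == z i)) G w.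
  by move=> zx; apply: eq_bigl => w; rewrite agree_setU1 (agree_congr w zx).
apply: (@le_trans _ _ (\sum_(z | agree S z x)
    mu z * (s (z i) ^+ 2 / (m (z i) * (a1 * F))))).
  apply: le_mass_sum => z zx z0.
  have mz : 0 < m (z i).
    by rewrite /m -(sumE _ z zx); exact: (marginal_gt0 (i |: S) z0).
  have -> : cond_mean mu (i |: S) f z - r = s (z i) / m (z i).
    rewrite /cond_mean /marginal !(sumE _ z zx) -/(m (z i)) /s /tilt_marginal.
    under [in RHS]eq_bigr do rewrite mulrBr.
    rewrite sumrB -mulr_suml -/(m (z i)) mulrBl [m _ * r]mulrC mulfK //.
    by rewrite gt_eqF.
  have hM : a1 * M <= m (z i).
    rewrite /M -(eq_marginal zx) /m -(sumE _ z zx); exact: hb.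
  rewrite expr_div_n -mulrA ler_wpM2l ?sqr_ge0 // -invfM lef_pV2 ?posrE ?mulr_gt0 ?exprn_gt0 //.
  rewrite expr2 -mulrA ler_pM2l // FE mulrCA [leRHS]mulrC.
  by rewrite ler_pM2l.
rewrite (partition_big (fun z => z i) xpredT) //= mulr_sumr.
apply: ler_sum => u _.
rewrite (eq_bigr (fun z => mu z * (s u ^+ 2 / (m u * (a1 * F))))); last first.
  by move=> z /andP[_ /eqP ->].
rewrite -mulr_suml -/(m u) -/(s u) invfM mulrCA [leRHS]mulrC ler_wpM2l ?sqr_ge0 //.
have [->|mu0] := eqVneq (m u) 0.
  by rewrite mul0r invr_ge0 mulr_ge0 ?ltW.
by rewrite mulrA divff // mul1r.
Qed.

(** Chi-square is bounded by total variation at cost 2 / (a1 F), total variation by local defects at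
    cost a2^-2, and defects by Dirichlet terms at cost F / 2; the factors involving F cancel. *)
Lemma sum_chi2_le S x : 0 < mu x ->
  let r := cond_mean mu S f x in
  \sum_(i | i \notin S)
    \sum_(z | agree S z x) mu z * ((cond_mean mu (i |: S) f z - r) ^+ 2 / r) <=
  (a1 * a2 ^+ 2)^-1 *
  \sum_(i | i \notin S) \sum_(z | agree S z x) mu z * site_dirichlet i z.
Proof.
move=> x0 /=; set r := cond_mean mu S f x; set F := \sum_(z | agree S z x) mu z * f z.
have F0 : 0 < F by exact: mean_gt0.
have t0 : tilt mu S x f r (fun=> 1) = 0.
  rewrite /tilt; under eq_bigr do rewrite mulr1 mulrBr.
  rewrite sumrB -mulr_suml -/F /r /cond_mean -/F -/(marginal mu S x) mulrC.
  by rewrite divfK ?subrr // gt_eqF // marginal_gt0.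
pose tau i := 2^-1 * \sum_u `|tilt_marginal mu S x f r i u|.
have aF0 : 0 < a1 * F by exact: mulr_gt0.
apply: (@le_trans _ _ ((a1 * F)^-1 * (2 * \sum_i tau i ^+ 2))).
  rewrite [leRHS](_ : _ = \sum_i (a1 * F)^-1 * (2 * tau i ^+ 2)); last first.
    by rewrite -!mulr_sumr.
  rewrite [leLHS]big_mkcond; apply: ler_sum => i _ /=.
  have tau0 : 0 <= (a1 * F)^-1 * (2 * tau i ^+ 2).
    apply: mulr_ge0; first by rewrite invr_ge0 ltW.
    by apply: mulr_ge0 => //; exact: sqr_ge0.
  case: ifP => // iS; apply: le_trans (chi2_le_tilt_marginal iS x0) _.
  apply: ler_wpM2l; first by rewrite invr_ge0 ltW.
  apply: sum_sqr_le_half_l1.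
  rewrite -[RHS]t0 -(sum_tilt_marginal mu S x f r i (fun=> 1)).
  by apply: eq_bigr => u _; rewrite mulr1.
have h1 := tilt_marginal_l2_le hq hJ J0 t0 a2_gt0 hJ2.
have h2 : \sum_(i | i \notin S) local_defect mu q S x f i ^+ 2 <=
    F / 2 * \sum_(i | i \notin S) \sum_(z | agree S z x) mu z * site_dirichlet i z.
  by rewrite mulr_sumr; apply: ler_sum => i iS; exact: sqr_local_defect_le.
have := le_trans h1 h2; rewrite -/tau => h.
set A := \sum_i _ in h *; set B := \sum_(i | _) _ in h *.
have -> : (a1 * F)^-1 * (2 * A) = (a1 * a2 ^+ 2)^-1 * (2 / F * (a2 ^+ 2 * A)).
  by field; rewrite !gt_eqF.
have -> : B = 2 / F * (F / 2 * B) by field; rewrite gt_eqF.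
have c0 : 0 <= (a1 * a2 ^+ 2)^-1.
  by rewrite invr_ge0 mulr_ge0 ?sqr_ge0 ?(ltW a1_gt0).
by apply: (ler_wpM2l c0); rewrite ler_wpM2l // divr_ge0 // ltW.
Qed.

Lemma sum_mean_xlnx_setU1_le S :
  \sum_(i | i \notin S) (mean_xlnx f (i |: S) - mean_xlnx f S) <=
  (a1 * a2 ^+ 2)^-1 *
  \sum_(i | i \notin S) \sum_z mu z * site_dirichlet i z.
Proof.
apply: le_trans (ler_sum _ (fun i _ => mean_xlnx_setU1_le S i f_gt0)) _.
(* By the tower property both sides are averages of conditional means, so it suffices to compare
   them class by class. *)
have glob (G : I -> {ffun I -> X} -> R) :
    \sum_(i | i \notin S) \sum_z mu z * G i z =
    \sum_x mu x * (\sum_(i | i \notin S) cond_mean mu S (G i) x).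
  under [RHS]eq_bigr do rewrite mulr_sumr.
  rewrite [RHS]exchange_big /=; apply: eq_bigr => i _.
  transitivity (\sum_z mu z * (1 * G i z)).
    by apply: eq_bigr => z _; rewrite mul1r.
  rewrite -(@sum_cond_mean S (fun=> 1) (G i)) //.
  by apply: eq_bigr => z _; rewrite mul1r.
rewrite !glob mulr_sumr.
rewrite [leRHS](eq_bigr (fun x => mu x * ((a1 * a2 ^+ 2)^-1 *
  \sum_(i | i \notin S) cond_mean mu S (site_dirichlet i) x))); last first.
  by move=> x _; rewrite mulrCA.
apply: le_mass_sum => x _ x0.
rewrite /cond_mean -!mulr_suml mulrA.
rewrite ler_wpM2r ?invr_ge0 ?(ltW (marginal_gt0 S x0)) //.
apply: le_trans (sum_chi2_le S x0); apply: ler_sum => i _; apply: ler_sum => z zx.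
by rewrite -/(cond_mean mu (i |: S) f z) -/(cond_mean mu S f z) (eq_cond_mean f zx).
Qed.

(** Average over the next revealed site [i]. The induction hypothesis at [i |: S] misses exactly the
    term of [i]; the one-step bound, summed over [i], restores all the missing terms, leaving as
    many copies of the full sum as there are unrevealed sites. *)
Lemma mean_xlnx_le S :
  mean_xlnx f [set: I]%SET - mean_xlnx f S <=
  (a1 * a2 ^+ 2)^-1 *
  \sum_(i | i \notin S) \sum_z mu z * site_dirichlet i z.
Proof.
have [n] := ubnP #|~: S|; elim: n S => // n IH S hn.
pose G i := \sum_z mu z * site_dirichlet i z.
set C := (a1 * a2 ^+ 2)^-1.
have [S0|] := posnP #|~: S|.
  move/eqP: S0; rewrite finset.cards_eq0 => /eqP S0.
  have -> : S = [set: I]%SET by rewrite -[S]finset.setCK S0 finset.setC0.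
  by rewrite subrr big1 ?mulr0 // => i; rewrite inE.
move=> Spos.
have cS : \sum_(i | i \notin S) (1 : R) = #|~: S|%:R.
  by rewrite sumr_const; congr _%:R; apply: eq_card => i; rewrite !inE.
have cS0 : (0 : R) < #|~: S|%:R by rewrite ltr0n.
rewrite -(ler_pM2l cS0) -{1}cS mulr_suml.
rewrite (eq_bigr (fun i => (mean_xlnx f [set: I]%SET - mean_xlnx f (i |: S)) +
  (mean_xlnx f (i |: S) - mean_xlnx f S))); last by move=> i _; ring.
rewrite big_split /=.
apply: (@le_trans _ _ (\sum_(i | i \notin S)
   C * (\sum_(j | j \notin S) G j - G i) + C * \sum_(i | i \notin S) G i)).
  apply: lerD; last exact: sum_mean_xlnx_setU1_le.
  apply: ler_sum => i iS.
  have := IH (i |: S); rewrite -/C.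
  have -> : \sum_(j | j \notin i |: S) G j = \sum_(j | j \notin S) G j - G i.
    rewrite [X in _ = X - _](bigD1 i iS) /= [RHS]addrC addKr.
    by apply: eq_bigl => j; rewrite !inE negb_or andbC.
  apply; rewrite -ltnS; apply: leq_trans hn; rewrite ltnS; apply: proper_card.
  rewrite finset.properC; apply/properP; split; first exact: finset.subsetUr.
  by exists i; rewrite ?setU11.
rewrite -mulr_sumr -mulrDr sumrB subrK mulrCA ler_wpM2l //.
  by rewrite invr_ge0 mulr_ge0 ?sqr_ge0 ?(ltW a1_gt0).
by rewrite -cS mulr_suml; apply: ler_sum => i _; rewrite mul1r.
Qed.

End EntropyFactorization.

(** * From functions on the support to functions on all configurations *)

Section SupportFunctions.
Context {R : realType} {X I : finType} (mu : spin_system R X I).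
Implicit Types (z w : {ffun I -> X}) (i j : I) (S : {set I}).
Implicit Types (f g : supp mu -> R).

(* The value off the support is immaterial; 1 keeps extensions positive. *)
Definition extend f z : R := if insub z is Some x then f x else 1.

Lemma extendE f (x : supp mu) : extend f (val x) = f x.
Proof. by rewrite /extend valK. Qed.

Lemma extend_gt0 f : (forall x, 0 < f x) -> forall z, 0 < extend f z.
Proof. by move=> f0 z; rewrite /extend; case: insub. Qed.

Lemma sum_supp (F : {ffun I -> X} -> R) :
  \sum_(x : supp mu) F (val x) = \sum_(z | 0 < mu z) F z.
Proof.
rewrite [RHS](reindex_omap (val : supp mu -> _) insub) => [|z z0]; last by rewrite insubT.
by apply: eq_bigl => x; rewrite valK eqxx andbT (valP x).
Qed.

Lemma sum_mass_supp (F : {ffun I -> X} -> R) :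
  \sum_(x : supp mu) mu (val x) * F (val x) = \sum_z mu z * F z.
Proof.
rewrite (sum_supp (fun z => mu z * F z)) big_mkcond; apply: eq_bigr => z _.
case: ifPn => // z0; suff -> : mu z = 0 by rewrite mul0r.
by apply/eqP; move: z0; rewrite lt0r mass_ge0 andbT negbK.
Qed.

Lemma expect_extend f : expect f = \sum_z mu z * extend f z.
Proof. by rewrite -sum_mass_supp; apply: eq_bigr => x _; rewrite extendE. Qed.

Lemma entropy_extend f : entropy f =
  mean_xlnx mu (extend f) [set: I]%SET - mean_xlnx mu (extend f) finset.set0.
Proof.
rewrite mean_xlnxT mean_xlnx0 -expect_extend /entropy; congr (_ - _).
rewrite -(sum_mass_supp (fun z => extend f z * ln (extend f z))).
by apply: eq_bigr => x _; rewrite extendE.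
Qed.

Lemma glauberE (x y : supp mu) : glauber x y = #|I|%:R^-1 *
  \sum_i site_cond mu i (val x) (val y i) *
    (agree [set~ i]%SET (val y) (val x))%:R.
Proof.
congr (_ * _); apply: eq_bigr => i _; congr (_ * _).
rewrite agree_sym.
case: (boolP (agree _ _ _)) => [xy|].
  rewrite big1 // => j ji; suff -> : val x j == val y j by [].
  by rewrite (agreeP _ _ _ xy) // !inE.
rewrite negb_forall_in => /exists_inP[j]; rewrite !inE => ji xy.
by rewrite (bigD1 j) //= (negPf xy) mul0r.
Qed.

Lemma glauber_ge0 (x y : supp mu) : 0 <= glauber x y.
Proof.
rewrite glauberE mulr_ge0 ?invr_ge0 // sumr_ge0 // => i _.
rewrite mulr_ge0 // site_cond_upd divr_ge0 ?mass_ge0 //.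
by apply: sumr_ge0 => b _; exact: mass_ge0.
Qed.

Lemma glauber_reversible (x y : supp mu) :
  mu (val x) * glauber x y = mu (val y) * glauber y x.
Proof.
rewrite !glauberE 2![mu _ * _]mulrCA; congr (_ * _).
rewrite !mulr_sumr; apply: eq_bigr => i _.
rewrite [agree _ (val x) _]agree_sym.
case: (boolP (agree _ _ _)) => [yx|_]; last by rewrite !mulr0.
rewrite !mulr1 !site_cond_upd -(agree_setC1_upd yx).
have xy : agree [set~ i]%SET (val x) (val y) by rewrite agree_sym.
rewrite -(agree_setC1_upd xy).
have -> : \sum_b mu (upd (val x) i b) = \sum_b mu (upd (val y) i b).
  by apply: eq_bigr => b _; rewrite (agree_setC1_upd yx) upd_upd.
by rewrite mulrCA mulrA.
Qed.

(** The ratio of the marginals is a conditional probability occurring in the infimum [beta], with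
    [z] as both conditioning and target configuration. *)
Lemma marginal_setU1_ge (a1 : R) S i z : (a1%:E <= beta mu)%E ->
  i \notin S -> 0 < mu z -> a1 * marginal mu S z <= marginal mu (i |: S) z.
Proof.
move=> hb iS z0; rewrite -ler_pdivlMr ?marginal_gt0 //.
have -> : marginal mu (i |: S) z / marginal mu S z = cond_prob mu S z i (z i).
  congr (_ / _); apply: eq_bigl => w; exact: agree_setU1.
rewrite -lee_fin; apply: le_trans hb _.
apply: (@le_trans _ _ (beta_site mu i S)).
  apply: (@le_trans _ _ (ereal_inf [set beta_site mu i S | i in [set i : I | i \notin S]])).
    apply: ereal_inf_lbound; exists S => //=.
    by apply/properP; split; [exact: finset.subsetT|exists i].
  by apply: ereal_inf_lbound; exists i.
apply: (@le_trans _ _ (ereal_inf [set (cond_prob mu S z i (y i))%:E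
      | y in [set y : {ffun I -> X} | agree S y z /\ 0 < mu y]])).
  by apply: ereal_inf_lbound; exists z => //=; exact: marginal_gt0.
by apply: ereal_inf_lbound; exists z => //=; split => //; exact: agree_refl.
Qed.

Context (q : I -> {ffun I -> X} -> X -> R) (hq : is_cond_version mu q).

(** On the support, [q] is forced to be the conditional probability, and updates leaving the support
    have probability zero, so the sum extends to all configurations. *)
Lemma sum_glauber (h : {ffun I -> X} -> R) (x : supp mu) :
  \sum_y glauber x y * h (val y) = #|I|%:R^-1 * \sum_i site_avg q i h (val x).
Proof.
under eq_bigr do rewrite glauberE -mulrA mulr_suml.
rewrite -mulr_sumr exchange_big /=; congr (_ * _); apply: eq_bigr => i _.
rewrite /site_avg.
have E a : q i (val x) a = site_cond mu i (val x) a.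
  by rewrite site_cond_upd (version_pos hq) // (valP x).
pose F z := site_cond mu i (val x) (z i) * h z.
transitivity (\sum_(z | agree [set~ i]%SET z (val x)) F z); last first.
  rewrite sum_agree_setC1; apply: eq_bigr => a _.
  by rewrite /F upd_eq E.
rewrite (eq_bigr (fun y : supp mu =>
    if agree [set~ i]%SET (val y) (val x) then F (val y) else 0)); last first.
  move=> y _; rewrite /F; case: ifP => _; first by rewrite mulr1.
  by rewrite mulr0 mul0r.
rewrite (sum_supp (fun z => if agree [set~ i]%SET z (val x) then F z else 0)).
rewrite [LHS]big_mkcond [RHS]big_mkcond /=; apply: eq_bigr => z _.
case: ifPn => // z0; case: ifP => // zx.
rewrite /F site_cond_upd -(agree_setC1_upd zx).
suff -> : mu z = 0 by rewrite !mul0r.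
by apply/eqP; move: z0; rewrite lt0r mass_ge0 andbT negbK.
Qed.

Lemma sum_glauber1 (x : supp mu) : (0 < #|I|)%N -> \sum_y glauber x y = 1.
Proof.
move=> I0; have := sum_glauber (fun=> 1) x.
under eq_bigr do rewrite mulr1.
move=> ->; under eq_bigr do rewrite (site_avg_cst hq).
by rewrite sumr_const mulVf // pnatr_eq0 -lt0n.
Qed.

Lemma dirichlet_ln f : (0 < #|I|)%N -> (forall x, 0 < f x) ->
  dirichlet f (fun x => ln (f x)) = #|I|%:R^-1 *
    \sum_i \sum_z mu z * site_dirichlet q (extend f) i z.
Proof.
move=> I0 f0; rewrite /dirichlet /expect /generator.
pose h z := ln (extend f z).
have n0 : (#|I|%:R : R) != 0 by rewrite pnatr_eq0 -lt0n.
pose G z := extend f z * (#|I|%:R^-1 * \sum_i (h z - site_avg q i h z)).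
rewrite (eq_bigr (fun x => mu (val x) * G (val x))); last first.
  move=> x _; rewrite /G extendE; congr (_ * (_ * _)).
  rewrite (eq_bigr (fun y => glauber x y * h (val y))); last first.
    by move=> y _; rewrite /h extendE.
  rewrite sum_glauber sumrB sumr_const mulrBr -[h _ *+ _]mulr_natl mulKf //.
  by rewrite opprB; congr (_ - _); rewrite /h extendE.
rewrite sum_mass_supp.
transitivity (#|I|%:R^-1 * \sum_i \sum_z
    mu z * (extend f z * (h z - site_avg q i h z))).
  rewrite exchange_big mulr_sumr; apply: eq_bigr => z _ /=.
  rewrite /G -mulr_sumr -mulr_sumr; ring.
congr (_ * _); apply: eq_bigr => i _.
(* Self-adjointness on the class of the empty set still asks for a base configuration; one exists
   because [mu] has mass 1. *)
have [x _] : exists x : {ffun I -> X}, True.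
  have [x _|T0] := pickP (@predT {ffun I -> X}); first by exists x.
  have := mass_sum1 mu; rewrite big_pred0 // => /eqP.
  by rewrite eq_sym oner_eq0.
have sum0 (F : {ffun I -> X} -> R) :
    \sum_(z | agree finset.set0 z x) F z = \sum_z F z.
  by apply: eq_bigl => z; apply/agreeP => j; rewrite inE.
have := site_avg_selfadjoint (S := finset.set0) hq x (extend f) h (i := i).
rewrite inE => /(_ isT); rewrite !sum0 => sa.
rewrite (eq_bigr (fun z => mu z * (extend f z * h z) -
  mu z * (extend f z * site_avg q i h z))); last by move=> z _; ring.
by rewrite sumrB -sa -sumrB; apply: eq_bigr => z _; rewrite /site_dirichlet /h; ring.
Qed.

End SupportFunctions.

(** The factorization bound started from the empty set; the factor [#|I|] undoes the uniform choice
    of site in the dynamics. *)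
Lemma entropy_dirichlet_le (R : realType) (X I : finType) (mu : spin_system R X I)
    (J : I -> I -> R) (a1 a2 : R) : 0 < a1 -> 0 < a2 ->
  (a1%:E <= beta mu)%E -> interdependence mu J -> opnorm2 J <= 1 - a2 ->
  mLSI mu (2 * #|I|%:R * a1^-1 * a2 ^- 2).
Proof.
move=> a10 a20 hb [J0 [q hq hJ]] hJ2 f f0.
have h := mean_xlnx_le hq hJ J0 a10 a20 hJ2
  (fun S i z => @marginal_setU1_ge _ _ _ mu a1 S i z hb) (extend_gt0 f0) finset.set0.
rewrite entropy_extend; apply: le_trans h _.
rewrite (eq_bigl xpredT) => [|i]; last by rewrite inE.
have [I0|I0] := posnP #|I|.
  have noI (i : I) : False by have := card0_eq I0 i; rewrite inE.
  rewrite big1 => [|i]; last by case: (noI i).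
  by rewrite I0 !mulr0 !mul0r.
rewrite (dirichlet_ln hq) // le_eqVlt; apply/orP; left; apply/eqP.
have n0 : (#|I|%:R : R) != 0 by rewrite pnatr_eq0 -lt0n.
by field; rewrite n0 !gt_eqF.
Qed.

(** * Limits and derivatives of finite sums; monotonicity from the derivative *)

Section Calculus.
Context {R : realType}.

Lemma cvg_fin_sum (T : finType) (u : T -> R^nat) (l : T -> R) :
  (forall x, u x @ \oo --> l x) ->
  (fun n => \sum_x u x n) @ \oo --> \sum_x l x.
Proof.
move=> ul; elim: (index_enum T) => [|x r IH].
  by under eq_fun do rewrite big_nil; rewrite big_nil; exact: cvg_cst.
under eq_fun do rewrite big_cons; rewrite big_cons.
by apply: cvgD => //; exact: ul.
Qed.

Lemma is_derive_fin_sum (T : finType) (F : T -> R -> R) (d : T -> R) (t : R) :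
  (forall x, is_derive t 1 (F x) (d x)) ->
  is_derive t 1 (fun s => \sum_x F x s) (\sum_x d x).
Proof.
move=> Fd; elim: (index_enum T) => [|x r IH].
  by under eq_fun do rewrite big_nil; rewrite big_nil; exact: is_derive_cst.
under eq_fun do rewrite big_cons; rewrite big_cons.
exact: is_deriveD.
Qed.

Lemma is_derive_scale (g : R -> R) (c d t : R) : is_derive t 1 g d ->
  is_derive t 1 (fun s => c * g s) (c * d).
Proof. exact: is_deriveZ. Qed.

Lemma is_derive_mul (g h : R -> R) (d e t : R) :
  is_derive t 1 g d -> is_derive t 1 h e ->
  is_derive t 1 (fun s => g s * h s) (d * h t + g t * e).
Proof.
move=> gd he; have -> : d * h t + g t * e = g t *: e + h t *: d.
  by rewrite addrC [d * _]mulrC.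
exact: is_deriveM.
Qed.

Lemma is_derive_expRM (c t : R) :
  is_derive t 1 (fun s => expR (c * s)) (expR (c * t) * c).
Proof.
apply: (@is_derive1_comp _ expR (fun s => c * s)).
by rewrite -[X in is_derive _ _ _ X]mulr1; exact: is_derive_scale.
Qed.

Lemma derive_le0_nincr (g dg : R -> R) :
  (forall t : R, 0 <= t -> is_derive t 1 g (dg t)) ->
  (forall t : R, 0 <= t -> dg t <= 0) ->
  forall t : R, 0 <= t -> g t <= g 0.
Proof.
move=> gd dg0 t t0.
have gd' (s : R) : s \in `]0, t[%R -> is_derive s 1 g (dg s).
  by rewrite in_itv /= => /andP[/ltW s0 _]; exact: gd.
apply: (@ler0_derive1_le_cc _ g 0 t); rewrite ?in_itv /= ?lexx ?t0 //.
- by move=> s /gd' [].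
- move=> s st; rewrite derive1E; have [_ ->] := gd' s st.
  by apply: dg0; move: st; rewrite in_itv /= => /andP[/ltW].
- apply: derivable_within_continuous => s.
  by rewrite in_itv /= => /andP[s0 _]; have [] := gd s s0.
Qed.

End Calculus.

(** * Exponentials of finite matrices and the linear equation they solve *)

Section OperatorExponential.
Context {R : realType} {T : finType}.
Implicit Types (A P : T -> T -> R) (f g : T -> R).

Definition matop A f : T -> R := fun x => \sum_y A x y * f y.

Definition expop A (t : R) f : T -> R :=
  fun x => limn (series (fun k => exp_coeff t k * iter k (matop A) f x)).

Let coef A f x (k : nat) := iter k (matop A) f x / k`!%:R.

Let series_coef A f x t :
  series (fun k => exp_coeff t k * iter k (matop A) f x) = pseries (coef A f x) t.
Proof.
rewrite /pseries; congr series; apply/funext => k.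
by rewrite /coef /exp_coeff /= [LHS]mulrC mulrA mulrAC.
Qed.

Let iter_matop_le A f k x :
  `|iter k (matop A) f x| <= (\sum_x \sum_y `|A x y|) ^+ k * \sum_x `|f x|.
Proof.
have leS (F : T -> R) z : (forall y, 0 <= F y) -> F z <= \sum_y F y.
  by move=> F0; rewrite (bigD1 z) //= lerDl sumr_ge0.
elim: k x => [|k IH] x.
  by rewrite expr0 mul1r /= (leS (fun x => `|f x|)).
rewrite iterS exprS -mulrA; apply: le_trans (ler_norm_sum _ _ _) _.
apply: (@le_trans _ _ ((\sum_y `|A x y|) *
    ((\sum_x \sum_y `|A x y|) ^+ k * \sum_x `|f x|))).
  by rewrite mulr_suml; apply: ler_sum => y _; rewrite normrM ler_wpM2l.
rewrite ler_wpM2r //; last by apply: (leS (fun x => \sum_y `|A x y|)) => y; exact: sumr_ge0.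
by rewrite mulr_ge0 ?exprn_ge0 ?sumr_ge0 // => y _; exact: sumr_ge0.
Qed.

Lemma is_cvg_expop A f x t :
  cvgn (series (fun k => exp_coeff t k * iter k (matop A) f x)).
Proof.
apply: normed_cvg; set C := \sum_x \sum_y `|A x y|; set B := \sum_x `|f x|.
have C0 : 0 <= C by apply: sumr_ge0 => y _; exact: sumr_ge0.
have B0 : 0 <= B by exact: sumr_ge0.
apply: (@series_le_cvg _ _ (fun k => B * exp_coeff (C * `|t|) k)).
- by move=> k /=.
- by move=> k; rewrite mulr_ge0 // exp_coeff_ge0 // mulr_ge0.
- move=> k /=; rewrite /exp_coeff /= !normrM normfV normrX.
  rewrite [`|_%:R|]ger0_norm // exprMn.
  have -> : B * (C ^+ k * `|t| ^+ k / k`!%:R) = `|t| ^+ k / k`!%:R * (C ^+ k * B).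
    by ring.
  by rewrite ler_wpM2l ?divr_ge0 ?exprn_ge0 // iter_matop_le.
- exact: (@is_cvg_seriesZ _ _ B (is_cvg_series_exp_coeff (C * `|t|))).
Qed.

Lemma expop0 A f : expop A 0 f = f.
Proof.
apply/funext => x; apply: lim_near_cst => //.
near=> n; have n0 : (0 < n)%N by near: n; exists 1%N.
rewrite seriesEnat /= -(prednK n0) big_nat_recl //= big1 ?addr0.
  by rewrite /exp_coeff /= expr0 fact0 divr1 mul1r.
by move=> i _; rewrite /exp_coeff /= expr0n mul0r mul0r.
Unshelve. all: by end_near. Qed.

Lemma expop_matop A t f : expop A t (matop A f) = matop A (expop A t f).
Proof.
apply/funext => x; apply: cvg_lim => //.
rewrite [X in X @ _](_ : _ = fun n => \sum_y A x y *
  series (fun k => exp_coeff t k * iter k (matop A) f y) n); last first.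
  apply/funext => n; rewrite /series /=.
  under [RHS]eq_bigr do rewrite mulr_sumr.
  rewrite exchange_big /=; apply: eq_bigr => k _.
  by rewrite -iterSr iterS /matop mulr_sumr; apply: eq_bigr => y _; ring.
by apply: cvg_fin_sum => y; apply: cvgMl_tmp; exact: is_cvg_expop.
Qed.

(** Termwise differentiation of an everywhere convergent power series: the derived coefficients for
    [f] are the coefficients for [matop A f]. *)
Lemma is_derive_expop A f x (t : R) :
  is_derive t 1 (fun s => expop A s f x) (matop A (expop A t f) x).
Proof.
have diffs g : pseries_diffs (coef A g x) = coef A (matop A g) x.
  apply/funext => k; rewrite /pseries_diffs /coef -iterSr factS natrM invfM.
  by rewrite mulrCA mulVKf // pnatr_eq0.
have cv g s : cvgn (pseries (coef A g x) s).
  by rewrite -series_coef; exact: is_cvg_expop.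
rewrite -expop_matop /expop.
rewrite [F in is_derive _ _ F _](_ : _ = fun s => limn (pseries (coef A f x) s)).
  rewrite series_coef -diffs.
  apply: (@pseries_snd_diffs _ _ (`|t| + 1)); rewrite ?diffs //.
  by rewrite [ltRHS]ger0_norm ?addr_ge0 // ltrDl.
by apply/funext => s; rewrite series_coef.
Qed.

(* Uniqueness for z' = A z, by a Gronwall argument on the Euclidean energy. *)
Lemma ode_zero A (z : R -> T -> R) : (forall x, z 0 x = 0) ->
  (forall (t : R) x, 0 <= t -> is_derive t 1 (fun s => z s x) (matop A (z t) x)) ->
  forall (t : R) x, 0 <= t -> z t x = 0.
Proof.
move=> z0 dz t x t0.
pose C := \sum_x \sum_y `|A x y|.
pose E s := \sum_x z s x * z s x.
pose dE s := \sum_x (matop A (z s) x * z s x + z s x * matop A (z s) x).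
have E0 (s : R) : 0 <= E s by apply: sumr_ge0 => y _; rewrite -expr2 sqr_ge0.
have hE (s : R) : 0 <= s -> is_derive s 1 E (dE s).
  by move=> s0; apply: is_derive_fin_sum => y; apply: is_derive_mul; exact: dz.
have hdE (s : R) : dE s <= 2 * C * E s.
  have -> : dE s = \sum_x \sum_y 2 * (A x y * (z s x * z s y)).
    apply: eq_bigr => y _; rewrite /matop mulr_suml mulr_sumr -big_split /=.
    by apply: eq_bigr => w _; ring.
  have sE v : `|z s v| ^+ 2 <= E s.
    rewrite real_normK ?num_real // expr2 /E (bigD1 v) //= lerDl.
    by apply: sumr_ge0 => u _; rewrite -expr2 sqr_ge0.
  move: (E s) sE => e sE.
  rewrite /C mulr_sumr mulr_suml; apply: ler_sum => y _.
  rewrite mulr_sumr mulr_suml; apply: ler_sum => w _.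
  rewrite -mulrA ler_pM2l //; apply: le_trans (ler_norm _) _.
  rewrite normrM ler_wpM2l // normrM; have h1 := sE y; have h2 := sE w.
  have := sqr_ge0 (`|z s y| - `|z s w|); nra.
pose g s := E s * expR (- (2 * C) * s).
have : g t <= g 0.
  apply: (@derive_le0_nincr _ g
    (fun s => dE s * expR (- (2 * C) * s) + E s * (expR (- (2 * C) * s) * - (2 * C)))) => //.
    by move=> s s0; apply: is_derive_mul; [exact: hE|exact: is_derive_expRM].
  move=> s _; have e0 := expR_gt0 (- (2 * C) * s); have := hdE s; nra.
have -> : g 0 = 0 by rewrite /g /E big1 ?mul0r // => y _; rewrite z0 mul0r.
rewrite pmulr_lle0 ?expR_gt0 // => Et.
have : E t == 0 by rewrite eq_le Et E0.
rewrite psumr_eq0 => [/allP /(_ x)|y _]; last by rewrite -expr2 sqr_ge0.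
by rewrite mem_index_enum mulf_eq0 orbb => /(_ isT) /eqP.
Qed.

(** All terms of the series are nonnegative and the zeroth one is [f x]. *)
Lemma expop_ge P f t x : (forall x y, 0 <= P x y) -> (forall x, 0 <= f x) ->
  0 <= t -> f x <= expop P t f x.
Proof.
move=> P0 f0 t0.
have it0 k y : 0 <= iter k (matop P) f y.
  elim: k y => [|k IH] y /=; first exact: f0.
  by apply: sumr_ge0 => w _; rewrite mulr_ge0.
apply: (@ler_cvg_to _ _ _ _ (fun=> f x) _ _ _ (cvg_cst _) (@is_cvg_expop P f x t)).
near=> n; have n0 : (0 < n)%N by near: n; exists 1%N.
rewrite seriesEnat /= -(prednK n0) big_nat_recl //=.
rewrite /exp_coeff /= expr0 fact0 divr1 mul1r lerDl sumr_ge0 // => i _.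
apply: mulr_ge0; last exact: (it0 i.+1).
by rewrite divr_ge0 // exprn_ge0.
Unshelve. all: by end_near. Qed.

(** Both sides solve the same linear equation from the same initial value. Writing the semigroup
    through the exponential of the nonnegative matrix [P] makes its positivity visible. *)
Lemma expop_sub1 P f t x : 0 <= t ->
  expop (fun x y => P x y - (x == y)%:R) t f x = expR (- t) * expop P t f x.
Proof.
move=> t0; set A := fun x y => _.
have matA g y : matop A g y = matop P g y - g y.
  rewrite /matop /A; under eq_bigr do rewrite mulrBl.
  rewrite sumrB; congr (_ - _); rewrite (bigD1 y) //= eqxx mul1r.
  by rewrite big1 ?addr0 // => w /negPf; rewrite eq_sym => ->; rewrite mul0r.
apply/eqP; rewrite -subr_eq0; apply/eqP.
pose z s y := expop A s f y - expR (-1 * s) * expop P s f y.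
have -> : - t = -1 * t by rewrite mulN1r.
rewrite -/(z t x); apply: (@ode_zero A z) t0.
  by move=> y; rewrite /z !expop0 mulr0 expR0 mul1r subrr.
move=> s y _; apply: (is_derive_eq (is_deriveB (is_derive_expop A f y s)
  (is_derive_mul (is_derive_expRM (-1) s) (is_derive_expop P f y s)))).
have -> : z s = fun y => expop A s f y - expR (-1 * s) * expop P s f y by [].
rewrite !matA /matop; under [in RHS]eq_bigr do rewrite mulrBr.
rewrite sumrB.
have -> : \sum_i P y i * (expR (-1 * s) * expop P s f i) =
    expR (-1 * s) * \sum_i P y i * expop P s f i.
  by rewrite mulr_sumr; apply: eq_bigr => i _; rewrite mulrCA.
ring.
Qed.

Lemma expopD_cst A f c t x : (forall x, \sum_y A x y = 0) -> 0 <= t ->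
  expop A t (fun y => f y + c) x = expop A t f x + c.
Proof.
move=> A0 t0; apply/eqP; rewrite -subr_eq0; apply/eqP.
pose z s y := expop A s (fun y => f y + c) y - (expop A s f y + c).
rewrite -/(z t x); apply: (@ode_zero A z) t0.
  by move=> y; rewrite /z !expop0 subrr.
move=> s y _; apply: (is_derive_eq (is_deriveB
  (is_derive_expop A (fun y => f y + c) y s)
  (is_deriveD (is_derive_expop A f y s) (is_derive_cst c s 1)))).
rewrite addr0 /matop -sumrB.
have : \sum_i A y i * c = 0 by rewrite -mulr_suml A0 mul0r.
move=> h; rewrite -[LHS]subr0 -[X in _ - X = _]h -sumrB; apply: eq_bigr => i _; rewrite /z; ring.
Qed.

Lemma expop_cst A c t x : (forall x, \sum_y A x y = 0) -> 0 <= t ->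
  expop A t (fun=> c) x = c.
Proof.
move=> A0 t0; apply/eqP; rewrite -subr_eq0; apply/eqP.
pose z s y := expop A s (fun=> c) y - c.
rewrite -/(z t x); apply: (@ode_zero A z) t0.
  by move=> y; rewrite /z expop0 subrr.
move=> s y _; apply: (is_derive_eq (is_deriveB
  (is_derive_expop A (fun=> c) y s) (is_derive_cst c s 1))).
rewrite subr0 /matop /z; under [RHS]eq_bigr do rewrite mulrBr.
by rewrite sumrB -mulr_suml A0 mul0r subr0.
Qed.

Lemma matop_selfadjoint (m : T -> R) A f g :
  (forall x y, m x * A x y = m y * A y x) ->
  \sum_x m x * (g x * matop A f x) = \sum_x m x * (matop A g x * f x).
Proof.
move=> rev.
transitivity (\sum_x \sum_y m y * A y x * (g x * f y)).
  apply: eq_bigr => x _; rewrite /matop !mulr_sumr; apply: eq_bigr => y _.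
  rewrite -rev; ring.
rewrite exchange_big /=; apply: eq_bigr => x _.
rewrite /matop mulr_suml mulr_sumr; apply: eq_bigr => y _; ring.
Qed.

Lemma expop_selfadjoint (m : T -> R) A f g t :
  (forall x y, m x * A x y = m y * A y x) ->
  \sum_x m x * (g x * expop A t f x) = \sum_x m x * (expop A t g x * f x).
Proof.
move=> rev.
have it k : \sum_x m x * (g x * iter k (matop A) f x) =
            \sum_x m x * (iter k (matop A) g x * f x).
  elim: k f => [//|k IH] h.
  by rewrite iterSr IH /= matop_selfadjoint.
pose S f x := series (fun k => exp_coeff t k * iter k (matop A) f x).
have h1 : (fun n => \sum_x m x * (g x * S f x n)) @ \oo -->
    \sum_x m x * (g x * expop A t f x).
  by apply: cvg_fin_sum => x; do 2 apply: cvgMl_tmp; exact: is_cvg_expop.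
have h2 : (fun n => \sum_x m x * (g x * S f x n)) @ \oo -->
    \sum_x m x * (expop A t g x * f x).
  rewrite [X in X @ _](_ : _ = fun n => \sum_x m x * (S g x n * f x)).
    apply: cvg_fin_sum => x; apply: cvgMl_tmp; apply: cvgMr_tmp.
    exact: is_cvg_expop.
  apply/funext => n.
  transitivity (\sum_(0 <= k < n) exp_coeff t k *
      \sum_x m x * (g x * iter k (matop A) f x)).
    under [RHS]eq_bigr do rewrite mulr_sumr.
    rewrite exchange_big /=; apply: eq_bigr => x _.
    by rewrite /S /series /= !mulr_sumr; apply: eq_bigr => k _; ring.
  under eq_bigr do rewrite it mulr_sumr.
  rewrite exchange_big /=; apply: eq_bigr => x _.
  by rewrite /S /series /= mulr_suml mulr_sumr; apply: eq_bigr => k _; ring.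
exact: (cvg_unique _ h1 h2).
Qed.

End OperatorExponential.

(** * Derivative and continuity of u ln u *)

Section XLnX.
Context {R : realType}.

Lemma is_derive_xlnx (u : R -> R) (d t : R) : 0 < u t -> is_derive t 1 u d ->
  is_derive t 1 (fun s => u s * ln (u s)) ((ln (u t) + 1) * d).
Proof.
move=> ut ud.
apply: (is_derive_eq (is_derive_mul ud (is_derive1_comp (is_derive1_ln ut) ud))).
by rewrite /=; field; rewrite gt_eqF.
Qed.

(* Along the squares d ^+ 2 the modulus of x ln x at 0 is linear in d. *)
Lemma xlnx_sqr_cvg (u : R) : 0 <= u ->
  (u + d ^+ 2) * ln (u + d ^+ 2) @[d --> 0^'+] --> u * ln u.
Proof.
rewrite le_eqVlt => /predU1P[<-|u0].
  rewrite mul0r.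
  apply: (@squeeze_cvgr _ _ _ _ (fun d : R => - (2 * d)) (fun=> 0)).
  - near=> d; have d0 : 0 < d by [].
    have d1 : d < 1 by near: d; exact: nbhs_right_lt.
    rewrite add0r lnXn // -mulr_natl.
    have h1 : ln d <= 0 by apply: ln_le0; exact: ltW.
    have h2 := sub_div_le_ln d0 (@ltr01 R).
    rewrite ln1 subr0 in h2.
    have {h2} : d - 1 <= d * ln d.
      by have := ler_wpM2l (ltW d0) h2; rewrite mulrCA divff ?mulr1 // gt_eqF.
    have d2 := sqr_ge0 d.
    move=> h3; apply/andP; split; nra.
  - rewrite -[X in _ --> X]oppr0 -[X in - X](mulr0 2).
    apply: cvgN; apply: cvgMl_tmp; apply: cvg_at_right_filter; exact: cvg_id.
  - exact: cvg_cst.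
apply: cvg_at_right_filter.
have c1 : u + d ^+ 2 @[d --> (0 : R)] --> u.
  rewrite -[X in _ --> X]addr0 -[X in _ + X](expr0n _ 2).
  by apply: cvgD; [exact: cvg_cst|exact: exprn_continuous].
apply: cvgM => //.
apply: (@cvg_comp _ _ _ (fun d : R => u + d ^+ 2) (@ln R) _ _ _ c1).
exact: continuous_ln.
Unshelve. all: by end_near. Qed.

End XLnX.

(** * Entropy along the Glauber semigroup *)

Section EntropyDecay.
Context {R : realType} {X I : finType} (mu : spin_system R X I).
Implicit Types (f g : supp mu -> R).

Definition glauber_gen (x y : supp mu) : R := glauber x y - (x == y)%:R.

Lemma generatorE : @generator R X I mu = matop glauber_gen.
Proof.
apply/funext => f; apply/funext => x; rewrite /generator /matop /glauber_gen.
under [RHS]eq_bigr do rewrite mulrBl.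
rewrite sumrB; congr (_ - _); rewrite (bigD1 x) //= eqxx mul1r.
by rewrite big1 ?addr0 // => y /negPf; rewrite eq_sym => ->; rewrite mul0r.
Qed.

Lemma semigroupE t f : semigroup t f = expop glauber_gen t f.
Proof. by rewrite /semigroup generatorE. Qed.

Lemma glauber_gen_reversible (x y : supp mu) :
  mu (val x) * glauber_gen x y = mu (val y) * glauber_gen y x.
Proof.
rewrite /glauber_gen !mulrBr glauber_reversible; congr (_ - _).
by rewrite [y == x]eq_sym; case: eqVneq => [->|_] //; rewrite !mulr0.
Qed.

Lemma expect_cst (c : R) : expect (fun _ : supp mu => c) = c.
Proof. by rewrite /expect (sum_mass_supp mu (fun=> c)) -mulr_suml mass_sum1 mul1r. Qed.

Lemma expectD_cst f c : expect (fun x => f x + c) = expect f + c.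
Proof.
rewrite -[in RHS](expect_cst c) /expect -big_split /=.
by apply: eq_bigr => x _; rewrite mulrDr.
Qed.

Lemma expect_gt0 f : (forall x, 0 < f x) -> 0 < expect f.
Proof.
move=> f0; rewrite expect_extend.
have e0 := extend_gt0 f0.
rewrite lt0r sumr_ge0 ?andbT => [|z _]; last by rewrite mulr_ge0 ?mass_ge0 // ltW.
apply/eqP => /eqP; rewrite psumr_eq0 => [/allP h|z _]; last first.
  by rewrite mulr_ge0 ?mass_ge0 // ltW.
have := mass_sum1 mu; rewrite big1 => [/eqP|z _]; first by rewrite eq_sym oner_eq0.
have := h z; rewrite mem_index_enum => /(_ isT).
by rewrite mulf_eq0 [extend _ _ == 0]gt_eqF // orbF => /eqP.
Qed.

(** Pointwise f (ln f - ln m) is at least f - m, which has mean zero. *)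
Lemma entropy_ge0 f : (forall x, 0 < f x) -> 0 <= entropy f.
Proof.
move=> f0; have m0 := expect_gt0 f0; set m := expect f in m0.
have h : \sum_x mu (val x) * (f x - m) = 0.
  have := expectD_cst f (- m); rewrite -/m => h; apply: etrans h _.
  exact: subrr.
have -> : entropy f = \sum_x mu (val x) * (f x * (ln (f x) - ln m)).
  rewrite /entropy -/m /expect; under [RHS]eq_bigr do rewrite mulrBr mulrBr.
  rewrite sumrB; congr (_ - _).
  rewrite -/(expect f) -/m /m /expect mulr_suml.
  by apply: eq_bigr => x _; rewrite mulrA.
rewrite -[leLHS]h; apply: ler_sum => x _; rewrite ler_wpM2l ?mass_ge0 //.
rewrite -ler_pdivrMl // mulrC; exact: sub_div_le_ln.
Qed.

Hypothesis I_gt0 : (0 < #|I|)%N.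
Context (q : I -> {ffun I -> X} -> X -> R) (hq : is_cond_version mu q).

Lemma sum_glauber_gen (x : supp mu) : \sum_y glauber_gen x y = 0.
Proof.
rewrite /glauber_gen sumrB (sum_glauber1 hq) //.
rewrite (bigD1 x) //= eqxx big1 ?addr0 ?subrr // => y /negPf.
by rewrite eq_sym => ->.
Qed.

(** The chain has not jumped by time [t] with probability at least [expR (- t)]. *)
Lemma semigroup_ge t f x : 0 <= t -> (forall x, 0 <= f x) ->
  expR (- t) * f x <= semigroup t f x.
Proof.
move=> t0 f0; rewrite semigroupE expop_sub1 // ler_wpM2l ?expR_ge0 //.
by apply: expop_ge => //; exact: glauber_ge0.
Qed.

Lemma semigroup_gt0 t f x : 0 <= t -> (forall x, 0 < f x) -> 0 < semigroup t f x.
Proof.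
move=> t0 f0; apply: lt_le_trans (semigroup_ge x t0 _).
  by rewrite mulr_gt0 ?expR_gt0.
by move=> y; exact: ltW.
Qed.

Lemma expect_generator f : \sum_x mu (val x) * generator f x = 0.
Proof.
have := matop_selfadjoint f (fun=> 1) glauber_gen_reversible.
rewrite generatorE; under eq_bigr do rewrite mul1r.
move=> ->; rewrite big1 // => x _; rewrite /matop.
by under eq_bigr do rewrite mulr1; rewrite sum_glauber_gen mul0r mulr0.
Qed.

(** The mean is conserved, so only the term u ln u varies, with derivative the mean of (ln u + 1) L
    u. The 1 vanishes by invariance, and self-adjointness turns the rest into the Dirichlet form. *)
Lemma is_derive_entropy_semigroup f (t : R) : 0 <= t -> (forall x, 0 < f x) ->
  is_derive t 1 (fun s => entropy (semigroup s f))
    (- dirichlet (semigroup t f) (fun x => ln (semigroup t f x))).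
Proof.
move=> t0 f0; set u := semigroup t f.
have u0 x : 0 < u x by exact: semigroup_gt0.
have du x : is_derive t 1 (fun s => semigroup s f x) (generator u x).
  rewrite /u generatorE semigroupE.
  rewrite [F in is_derive _ _ F _](_ : _ = fun s => expop glauber_gen s f x).
    exact: is_derive_expop.
  by apply/funext => s; rewrite semigroupE.
have dm : is_derive t 1 (fun s => expect (semigroup s f)) 0.
  exact: (is_derive_eq (is_derive_fin_sum (fun x =>
    is_derive_scale (mu (val x)) (du x))) (expect_generator u)).
have h := is_deriveB
  (is_derive_fin_sum (fun x => is_derive_scale (mu (val x))
    (is_derive_xlnx (u0 x) (du x))))
  (is_derive_xlnx (expect_gt0 u0) dm).
apply: (is_derive_eq h); rewrite mulr0 subr0.
have sa := matop_selfadjoint (fun x => ln (u x)) u glauber_gen_reversible.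
have -> : - dirichlet u (fun x => ln (u x)) =
    \sum_x mu (val x) * (u x * generator (fun x => ln (u x)) x).
  rewrite /dirichlet /expect -sumrN; apply: eq_bigr => x _; ring.
rewrite generatorE sa -generatorE.
under eq_bigr do rewrite mulrDl mul1r mulrDr [ln _ * _]mulrC.
by rewrite big_split /= expect_generator addr0.
Qed.

Lemma semigroupD_cst t f c : 0 <= t ->
  semigroup t (fun x => f x + c) = fun x => semigroup t f x + c.
Proof.
by move=> t0; apply/funext => x; rewrite !semigroupE expopD_cst //; exact: sum_glauber_gen.
Qed.

Lemma entropy_sqr_cvg f : (forall x, 0 <= f x) ->
  entropy (fun x => f x + d ^+ 2) @[d --> 0^'+] --> entropy f.
Proof.
move=> f0.
have m0 : 0 <= expect f by apply: sumr_ge0 => x _; rewrite mulr_ge0 ?mass_ge0.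
rewrite /entropy; apply: cvgB; last first.
  under eq_fun do rewrite expectD_cst; exact: xlnx_sqr_cvg.
rewrite /expect; elim: (index_enum _) => [|x r IH].
  by under eq_fun do rewrite big_nil; rewrite big_nil; exact: cvg_cst.
under eq_fun do rewrite big_cons; rewrite big_cons.
apply: cvgD => //; apply: cvgMl_tmp; exact: xlnx_sqr_cvg.
Qed.

(** For positive functions, entropy times [expR (c * s)] is nonincreasing. A function with zeros is
    first raised by [d ^+ 2], a shift that commutes with the semigroup, and then [d] tends to 0. *)
Lemma entropy_semigroup_le (c : R) f t :
  (forall g, (forall x, 0 < g x) ->
     c * entropy g <= dirichlet g (fun x => ln (g x))) ->
  (forall x, 0 <= f x) -> 0 <= t ->
  entropy (semigroup t f) <= entropy f * expR (- (c * t)).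
Proof.
move=> hc f0 t0.
have pos g : (forall x, 0 < g x) ->
    entropy (semigroup t g) <= entropy g * expR (- (c * t)).
  move=> g0; rewrite expRN ler_pdivlMr ?expR_gt0 //.
  have -> : entropy g = entropy (semigroup 0 g) * expR (c * 0).
    by rewrite semigroupE expop0 mulr0 expR0 mulr1.
  apply: (@derive_le0_nincr _ (fun s => entropy (semigroup s g) * expR (c * s))
    (fun s => - dirichlet (semigroup s g) (fun x => ln (semigroup s g x)) *
      expR (c * s) + entropy (semigroup s g) * (expR (c * s) * c))) => //.
    move=> s s0; apply: is_derive_mul; last exact: is_derive_expRM.
    exact: is_derive_entropy_semigroup.
  move=> s s0; have e0 := expR_gt0 (c * s).
  have := hc (semigroup s g) (fun x => semigroup_gt0 x s0 g0); nra.
have u0 x : 0 <= semigroup t f x.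
  by apply: le_trans (semigroup_ge x t0 f0); rewrite mulr_ge0 ?expR_ge0.
have hr := cvgMr_tmp (b := expR (- (c * t))) (entropy_sqr_cvg f0).
apply: (ler_cvg_to (entropy_sqr_cvg u0) (hr _)); near=> d.
rewrite -semigroupD_cst //; apply: pos => x.
by rewrite ltr_wpDl // exprn_gt0.
Unshelve. all: by end_near. Qed.

End EntropyDecay.

(** * From entropy to total variation, starting at a point mass *)

Section RapidMixing.
Context {R : realType} {X I : finType} (mu : spin_system R X I).
Implicit Types (f g : supp mu -> R).

(** With [r] the square root of [u], the right side is 2 r^2 ln r - r^2 + 1, and [r - 1 <= r * ln r]
    bounds it below by (r - 1)^2. *)
Lemma sqr_sqrt_sub1_le (u : R) : 0 <= u ->
  (Num.sqrt u - 1) ^+ 2 <= u * ln u - u + 1.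
Proof.
rewrite le_eqVlt => /predU1P[<-|u0].
  by rewrite sqrtr0 mul0r !sub0r sqrrN expr1n oppr0 add0r.
set r := Num.sqrt u; have r0 : 0 < r by rewrite sqrtr_gt0.
have uE : u = r ^+ 2 by rewrite sqr_sqrtr // ltW.
have h : r - 1 <= r * ln r.
  have := ler_wpM2l (ltW r0) (sub_div_le_ln r0 (@ltr01 R)).
  by rewrite mulrCA divff ?gt_eqF // mulr1 ln1 subr0.
rewrite uE lnXn // -mulr_natl; have := ler_wpM2l (ltW r0) h; lra.
Qed.

(* Cauchy-Schwarz applied to |g - 1| = |sqrt g - 1| (sqrt g + 1). *)
Lemma sqr_l1_le_entropy g : is_density g ->
  (\sum_x mu (val x) * `|g x - 1|) ^+ 2 <= 4 * entropy g.
Proof.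
case=> g0 g1; pose s x := (Num.sqrt (g x) + 1) ^+ 2.
have s0 x : 0 < s x by rewrite exprn_gt0 // ltr_wpDl // sqrtr_ge0.
have m1 : \sum_(x : supp mu) mu (val x) = 1.
  by rewrite -[RHS](expect_cst mu); apply: eq_bigr => x _; rewrite mulr1.
have ms1 : 1 <= \sum_(x : supp mu) mu (val x) * s x.
  rewrite -[leLHS]m1; apply: ler_sum => x _; rewrite ler_peMr ?mass_ge0 //.
  by rewrite -[leLHS](expr1n _ 2) lerXn2r ?nnegrE ?addr_ge0 ?sqrtr_ge0 // lerDr sqrtr_ge0.
(* Uses (r + 1)^2 <= 2 r^2 + 2 with r^2 = g, whose mean is 1. *)
have ms4 : \sum_(x : supp mu) mu (val x) * s x <= 4.
  have -> : (4 : R) = \sum_x mu (val x) * (2 * g x + 2).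
    under eq_bigr do rewrite mulrDr mulrCA.
    by rewrite big_split /= -mulr_sumr -mulr_suml m1 -/(expect g) g1; lra.
  apply: ler_sum => x _; rewrite ler_wpM2l ?mass_ge0 // /s.
  have := sqr_sqrtr (g0 x); set r := Num.sqrt _ => <-.
  by have := sqr_ge0 (r - 1); lra.
have cs := @weighted_cauchy_schwarz R (supp mu) xpredT _ (fun x => g x - 1) s
  (fun x => mass_ge0 mu (val x)) s0 (lt_le_trans ltr01 ms1).
apply: le_trans cs _; rewrite mulrC.
have e0 : \sum_x mu (val x) * ((g x - 1) ^+ 2 / s x) <= entropy g.
  have -> : entropy g = \sum_x mu (val x) * (g x * ln (g x) - g x + 1).
    under [RHS]eq_bigr do rewrite mulrDr mulrBr mulr1.
    rewrite big_split sumrB /= m1 -/(expect g) g1 subrK.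
    by rewrite /entropy g1 ln1 mulr0 subr0.
  apply: ler_sum => x _; rewrite ler_wpM2l ?mass_ge0 //.
  apply: le_trans (sqr_sqrt_sub1_le (g0 x)).
  rewrite ler_pdivrMr // /s -exprMn.
  have := sqr_sqrtr (g0 x); set r := Num.sqrt _ => <-.
  by rewrite le_eqVlt; apply/orP; left; apply/eqP; ring.
apply: le_trans (ler_wpM2l (le_trans ler01 ms1) e0) _.
rewrite ler_wpM2r //; apply: le_trans e0; apply: sumr_ge0 => x _.
by rewrite mulr_ge0 ?mass_ge0 // divr_ge0 ?sqr_ge0 // ltW.
Qed.

(** Chain rule for probabilities: each site of [S] contributes a factor at least [a1]. *)
Lemma marginal_ge_expr (a1 : R) (S : {set I}) z : 0 < a1 -> (a1%:E <= beta mu)%E ->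
  0 < mu z -> a1 ^+ #|S| <= marginal mu S z.
Proof.
move=> a10 hb z0; have [n] := ubnP #|S|; elim: n S => // n IH S Sn.
have [->|[i iS]] := finset.set_0Vmem S.
  by rewrite finset.cards0 expr0 marginal0.
rewrite -(finset.setD1K iS) finset.cardsU1 !inE eqxx /= exprS.
apply: le_trans (marginal_setU1_ge hb _ z0); last by rewrite !inE eqxx.
rewrite ler_pM2l //; apply: IH.
by move: Sn; rewrite (finset.cardsD1 i) iS.
Qed.

Definition point_density (y : supp mu) : supp mu -> R :=
  fun x => (x == y)%:R / mu (val y).

Lemma point_density_ge0 y x : 0 <= point_density y x.
Proof. by rewrite divr_ge0 ?mass_ge0. Qed.

Lemma sum_point_density y f : \sum_x mu (val x) * (point_density y x * f x) = f y.
Proof.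
rewrite (bigD1 y) //= big1 => [|x /negPf xy].
  by rewrite addr0 /point_density eqxx mul1r mulVKf // gt_eqF // (valP y).
by rewrite /point_density xy !mul0r mulr0.
Qed.

Lemma entropy_point_density y : entropy (point_density y) = - ln (mu (val y)).
Proof.
have e1 : expect (point_density y) = 1.
  rewrite -[RHS](sum_point_density y (fun=> 1)).
  by apply: eq_bigr => x _; rewrite mulr1.
rewrite /entropy e1 ln1 mulr0 subr0 /expect sum_point_density.
by rewrite /point_density eqxx mul1r lnV // posrE (valP y).
Qed.

Hypothesis I_gt0 : (0 < #|I|)%N.
Context (q : I -> {ffun I -> X} -> X -> R) (hq : is_cond_version mu q).

Lemma expect_semigroup f t : 0 <= t -> expect (semigroup t f) = expect f.
Proof.
move=> t0; transitivity (\sum_x mu (val x) * (1 * semigroup t f x)).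
  by apply: eq_bigr => x _; rewrite mul1r.
rewrite semigroupE (expop_selfadjoint f (fun=> 1)); last exact: glauber_gen_reversible.
apply: eq_bigr => x _; rewrite expop_cst ?mul1r //.
exact: (sum_glauber_gen I_gt0 hq).
Qed.

(** By reversibility, the density of the law at time [t] is the semigroup applied to the density of
    the starting point mass. *)
Lemma glauber_lawE t y x :
  glauber_law t y x = mu (val x) * semigroup t (point_density y) x.
Proof.
rewrite /glauber_law -[LHS](sum_point_density y) !semigroupE.
rewrite expop_selfadjoint; last exact: glauber_gen_reversible.
rewrite (bigD1 x) //= eqxx mulr1 big1 ?addr0 // => z /negPf ->.
by rewrite !mulr0.
Qed.

Lemma dTV_glauber_law_le t y (e : R) : 0 <= t -> 0 <= e ->
  entropy (semigroup t (point_density y)) <= e ^+ 2 ->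
  dTV (glauber_law t y) (fun x => mu (val x)) <= e.
Proof.
move=> t0 e0 he; set h := semigroup t (point_density y) in he *.
have dh : is_density h.
  split=> [x|].
    apply: le_trans (semigroup_ge x t0 (point_density_ge0 y)).
    by rewrite mulr_ge0 ?expR_ge0 ?point_density_ge0.
  rewrite expect_semigroup // -[RHS](sum_point_density y (fun=> 1)).
  by apply: eq_bigr => x _; rewrite mulr1.
have := sqr_l1_le_entropy dh; set s := \sum_x _ => hs.
have -> : dTV (glauber_law t y) (fun x => mu (val x)) = 2^-1 * s.
  congr (_ * _); apply: eq_bigr => x _.
  rewrite glauber_lawE -/h -{2}[mu (val x)]mulr1 -mulrBr normrM ger0_norm //.
  exact: mass_ge0.
have s0 : 0 <= s by apply: sumr_ge0 => x _; rewrite mulr_ge0 ?mass_ge0.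
rewrite -ler_sqr ?nnegrE ?mulr_ge0 ?invr_ge0 //; lra.
Qed.

End RapidMixing.

(** * Explicit decay rate and mixing time *)

Section MainEstimates.
Context {R : realType} {X I : finType} (mu : spin_system R X I).
Context (J : I -> I -> R) (a1 a2 : R).
Hypotheses (a1_gt0 : 0 < a1) (a2_gt0 : 0 < a2).
Hypotheses (hb : (a1%:E <= beta mu)%E) (hJ : interdependence mu J).
Hypothesis hJ2 : opnorm2 J <= 1 - a2.

Lemma entropy_semigroup_exp_le (f : supp mu -> R) t :
  (forall x, 0 <= f x) -> 0 <= t ->
  entropy (semigroup t f) <=
  entropy f * expR (- (a1 * a2 ^+ 2 / (2 * #|I|%:R) * t)).
Proof.
move=> f0 t0; have [I0|I0] := posnP #|I|.
  have T0 : [set: I]%SET = finset.set0.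
    by apply/eqP; rewrite -finset.cards_eq0 finset.cardsT I0.
  by rewrite !entropy_extend T0 !subrr mul0r.
have [J0 [q hq hqJ]] := hJ.
apply: (entropy_semigroup_le I0 hq) => // g g0.
have n0 : (0 : R) < #|I|%:R by rewrite ltr0n.
have := entropy_dirichlet_le a1_gt0 a2_gt0 hb hJ hJ2 g0.
set D := dirichlet _ _.
have -> : 2 * #|I|%:R * a1^-1 * a2 ^- 2 / 2 * D =
    (a1 * a2 ^+ 2 / (2 * #|I|%:R))^-1 * (D / 2).
  by field; rewrite !gt_eqF.
have c0 : 0 < a1 * a2 ^+ 2 / (2 * #|I|%:R).
  by rewrite divr_gt0 ?mulr_gt0 ?exprn_gt0.
rewrite ler_pdivlMl // => h.
(* The functional inequality yields twice the stated rate; nonnegativity of entropy allows weakening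
   it to the stated one. *)
have : 0 <= a1 * a2 ^+ 2 / (2 * #|I|%:R) * entropy g.
  by rewrite mulr_ge0 ?entropy_ge0 // ltW.
lra.
Qed.

(* The initial relative entropy is at most |I| ln (1/a1), so time of order
   |I| ln |I| brings it below e^-2. *)
Lemma tmix_le (L : R) : L = 1 + `|ln a1| -> expR 1 <= #|I|%:R :> R ->
  (tmix mu <= ((3 + L) * 2 / (a1 * a2 ^+ 2) * (#|I|%:R * ln #|I|%:R))%:E)%E.
Proof.
move=> LE he; set n : R := #|I|%:R in he *.
have n0 : 0 < n by apply: lt_le_trans he; exact: expR_gt0.
have I0 : (0 < #|I|)%N by rewrite -(ltr0n R).
have L1 : 1 <= L by rewrite LE lerDl.
have lnn : 1 <= ln n by rewrite -(expRK 1) ler_ln ?posrE ?expR_gt0.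
have k0 : 0 < a1 * a2 ^+ 2 by rewrite mulr_gt0 ?exprn_gt0.
set t := (3 + L) * 2 / (a1 * a2 ^+ 2) * (n * ln n).
have t0 : 0 <= t.
  have L0 : 0 < (3 + L) * 2 by lra.
  have ln0 : 0 < ln n by lra.
  by apply/ltW/mulr_gt0; [exact: divr_gt0|exact: mulr_gt0].
apply: ereal_inf_lbound; exists t => //; split => //.
apply: bigmax_le => [|y _]; first exact: expR_ge0.
have [J0 [q hq hqJ]] := hJ.
apply: (dTV_glauber_law_le I0 hq t0 (expR_ge0 _)).
apply: le_trans (entropy_semigroup_exp_le (point_density_ge0 y) t0) _.
rewrite -/n.
have -> : a1 * a2 ^+ 2 / (2 * n) * t = (3 + L) * ln n.
  by rewrite /t; field; rewrite !gt_eqF.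
have hent : entropy (point_density y) <= n * L.
  rewrite entropy_point_density lerNl.
  have hm := marginal_ge_expr [set: I]%SET a1_gt0 hb (valP y).
  rewrite marginalT finset.cardsT in hm.
  rewrite -ler_ln ?posrE ?exprn_gt0 ?(valP y) // in hm.
  apply: le_trans hm; rewrite lnXn // -mulr_natl -/n -mulrN ler_pM2l //.
  by rewrite LE lerNl -lerBlDl; have := ler_norm (- ln a1); rewrite normrN; lra.
apply: (@le_trans _ _ (n * L * expR (- ((3 + L) * ln n)))).
  by rewrite ler_wpM2r ?expR_ge0.
(* This reads L <= n^L. The entropy at time [t] is then at most n^(1 + L - (3 + L)) = n^-2 <= e^-2,
   which explains the constant [3 + L]. *)
have hL : L <= expR (L * ln n).
  apply: (@le_trans _ _ (expR L)); last by rewrite ler_expR; nra.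
  by have := expR_ge1Dx L; lra.
rewrite -{1}(lnK (x := n)) ?posrE //.
apply: (@le_trans _ _ (expR (ln n) * expR (L * ln n) * expR (- ((3 + L) * ln n)))).
  by rewrite ler_wpM2r ?expR_ge0 // ler_wpM2l ?expR_ge0.
rewrite -!expRD -expRM_natl ler_expR; lra.
Qed.

End MainEstimates.

Theorem theorem2p2 (R : realType) (X : finType) (a1 a2 : R)
    (ha1 : 0 < a1) (ha2 : 0 < a2) :
  (forall (I : finType) (mu : spin_system R X I) (J : I -> I -> R),
     (a1%:E <= beta mu)%E ->
     interdependence mu J -> opnorm2 J <= 1 - a2 ->
     mLSI mu (2 * #|I|%:R * a1^-1 * a2 ^- 2) /\
     (forall f : supp mu -> R, is_density f -> forall t : R, 0 <= t ->
        entropy (semigroup t f) <=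
        entropy f * expR (- (a1 * a2 ^+ 2 / (2 * #|I|%:R) * t)))) /\
  (forall (I : nat -> finType) (mu : forall n, spin_system R X (I n))
     (J : forall n, I n -> I n -> R),
     (fun n => #|I n|) @ \oo --> \oo ->
     (forall n, (a1%:E <= beta (mu n))%E) ->
     (forall n, interdependence (mu n) (J n) /\ opnorm2 (J n) <= 1 - a2) ->
     exists C : R, \forall n \near \oo,
       (tmix (mu n) <= (C * (#|I n|%:R * ln #|I n|%:R))%:E)%E).
Proof.
split=> [I mu J hb hJ hJ2|I mu J hI hb hJ].
  split; first exact: entropy_dirichlet_le hJ2.
  by move=> f [f0 _] t t0; exact: (entropy_semigroup_exp_le ha1 ha2 hb hJ hJ2).
exists ((3 + (1 + `|ln a1|)) * 2 / (a1 * a2 ^+ 2)).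
(* From size [N] on, the number of sites exceeds e, as the mixing bound requires. *)
pose N := (Num.truncn (expR 1 : R)).+1.
have hN : \forall n \near \oo, (N <= #|I n|)%N.
  exact: (hI [set k | (N <= k)%N] (nbhs_infty_ge N)).
near=> n; have hn : (N <= #|I n|)%N by near: n; exact: hN.
have [hJn hJ2n] := hJ n.
apply: (tmix_le ha1 ha2 (hb n) hJn hJ2n) => //.
apply: ltW; apply: lt_le_trans (truncnS_gt _) _.
by rewrite ler_nat.
Unshelve. all: by end_near. Qed.
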